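(* Let $m,n$ be non-negative integers with $n>m$. Let $m_1,n_1,m_2,n_2$ be non-negative integers with $m_1+n_1=m_2+n_2$ and $|m_1-n_1|<|m_2-n_2|$. Let $M$ and $N$ be any lists (possibly empty). Then (1) $\beta(M,m,n)\ge\beta(M,n,m)$, with equality if $M$ is empty; (2) $\beta(M,m_1,n_1,N)>\beta(M,m_2,n_2,N)$.
   Context: A list $(p_1,\dots,p_r)$ of non-negative integers ($r\ge1$) denotes the word $\mathbf c^{p_1}\mathbf d\mathbf c^{p_2}\mathbf d\cdots\mathbf d\mathbf c^{p_r}$ in non-commuting variables $\mathbf c$ (degree 1), $\mathbf d$ (degree 2); commas denote concatenation of lists. For a graded poset $P$ of rank $r+1$ with $\hat0,\hat1$ and $S\subseteq[r]$, $f_S$ counts chains $\hat0<x_1<\dots<x_j<\hat1$ with rank set $S$, $h_S=\sum_{T\subseteq S}(-1)^{|S-T|}f_T$, and the ab-index is $\sum_S h_S u_1\cdots u_r$ with $u_i=\mathbf b$ if $i\in S$, $\mathbf a$ otherwise. For Eulerian $P$ it is uniquely a polynomial $\Psi(P)$ in $\mathbf c=\mathbf a+\mathbf b$, $\mathbf d=\mathbf a\mathbf b+\mathbf b\mathbf a$. $B_{r+1}$ is the Boolean lattice of subsets of $[r+1]$. For a word $v$ of degree $r$, $\beta(v)$ is the coefficient of $v$ in $\Psi(B_{r+1})$; $\beta$ of a list is $\beta$ of the word it denotes. *)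

(* Defs.v *)
From HB Require Import structures.
From Stdlib Require Import ClassicalEpsilon.
From mathcomp Require Import all_boot all_order all_algebra.
From mathcomp Require Import finmap.
From mathcomp.multinomials Require Import monalg.

Set Implicit Arguments.
Unset Strict Implicit.
Unset Printing Implicit Defensive.

Import Order.TTheory Order.DefaultSetSubsetOrder GRing.Theory Num.Theory.
Local Open Scope ring_scope.

(* The free ring on two non-commuting letters.  The letters are booleans:
   (false, true) stands for (a, b) in ab-polynomials, and for (c, d) in
   cd-polynomials. *)
Definition ncpoly := {malg int[{fmonom bool}]}.

Definition ncvar (x : bool) : ncpoly := << FMonom [:: x] >>.

Section AbIndex.
Context {disp : Order.disp_t} {P : finTBPOrderType disp}.

(* Length of a longest chain of the interval [\bot, x]; in a graded poset this
   is the rank of x. *)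
Definition rank (x : P) : nat :=
  (\max_(C : {set P} | [forall y in C, (y <= x)%O] &&
                       [forall y in C, forall z in C, (y >=< z)%O]) #|C|).-1.

(* A subset S of [r] is encoded as a set of ordinals i < r, with i standing for
   the rank i + 1; enum lists it in increasing order. *)
Definition flag_f (r : nat) (S : {set 'I_r}) : nat :=
  #|[set x : #|S|.-tuple P | path <%O \bot%O (rcons x \top%O) &
       [seq rank y | y <- x] == [seq (val i).+1 | i <- enum S]]|.

Definition flag_h (r : nat) (S : {set 'I_r}) : int :=
  \sum_(T : {set 'I_r} | T \subset S) (-1) ^+ #|S :\: T| * (flag_f T)%:Z.

End AbIndex.

Definition ab_index (disp : Order.disp_t) (P : finTBPOrderType disp) : ncpoly :=
  let r := (rank (\top%O : P)).-1 in
  \sum_(S : {set 'I_r}) flag_h (P := P) S *: \prod_(i < r) ncvar (i \in S).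

(* The ab-polynomial obtained by c := a + b and d := ab + ba. *)
Definition cd_eval (F : ncpoly) : ncpoly :=
  let a := ncvar false in
  let b := ncvar true in
  let c := a + b in
  let d := a * b + b * a in
  \sum_(w <- msupp F) F@_w *: \prod_(x <- (w : seq bool)) (if x then d else c).

(* The unique cd-polynomial representing the ab-index; it exists when P is
   Eulerian, and is unspecified if there is none. *)
Definition cd_index (disp : Order.disp_t) (P : finTBPOrderType disp) : ncpoly :=
  epsilon (inhabits 0) (fun F : ncpoly => cd_eval F = ab_index P).

Definition cd_degree (v : seq bool) : nat :=
  \sum_(x <- v) (if x then 2 else 1)%N.

Definition boolean_lattice (n : nat) : finTBPOrderType _ := {set 'I_n}.

Definition cd_coef_boolean (v : seq bool) : int :=
  (cd_index (boolean_lattice (cd_degree v).+1))@_(FMonom v).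

Fixpoint cd_word (s : seq nat) : seq bool :=
  match s with
  | [::] => [::]
  | [:: p] => nseq p false
  | p :: s' => nseq p false ++ true :: cd_word s'
  end.

Definition beta (s : seq nat) : int := cd_coef_boolean (cd_word s).

(* Main.v *)
(** Let [b v := beta v / (|v| + 1)!] with [|v|] the degree of a cd-word [v].  If
    [X] is the exponential generating function of the ab-indices of the Boolean
    lattices, counting flags by their lowest element gives [X = e + e b X] with
    [e' = 1 + (a - b) e], hence [X' = (1 + X a)(1 + b X) = (1 + X b)(1 + a X)].
    Differentiating, [X'' = (c + X d) X'], which shows by induction that [X] is
    a cd-series; adding the two expressions of [X'] and comparing coefficients,
    [2 (|v| + 1) b v = 2 [v = 1] + [v = c w] b w + [v = w c] b w
       + sum_(v = x d y) b x b y].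
    Everything else follows from this recursion.

    For a word [Z], the numbers [w_i = b (c^i d Z)] are
    [w_i = (mu_1 - mu_(i+2)) / (i + 2)!], where the [mu_i] are the moments of a
    positive measure on [[0, 1]] that is symmetric under [x -> 1 - x]; in terms
    of the recursion, the mixed moments of [x^j (1 - x)^k] solve a linear system
    that obeys a minimum principle.  This gives [1/(i+3) < w_(i+1)/w_i], and
    [w_(i+1)/w_i <= 1/(i+2)] follows directly from the recursion.  The numbers
    [b (c^m d c^n d Z)] with fixed [m + n] are explicit alternating sums of the
    [w_i]; rewriting these sums with mixed moments makes
    [b (c^m d c^n d Z) > b (c^(n+1) d c^(m-1) d Z)], for [1 <= m <= n], a
    termwise comparison of binomial coefficients.  Together with (1), which
    follows by induction from the recursion, this orders all the
    [b (c^m d c^n d Z)].  When both [M] and [N] are nonempty, (2) is proved by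
    induction: the recursion only involves shorter instances of (2), the case
    where [M] or [N] is empty, and the products
    [b (A d c^m) b (c^n d Z)], which are ordered by the bounds on
    [w_(i+1)/w_i]. *)

From HB Require Import structures.
From Stdlib Require Import ClassicalEpsilon.
Require Import Defs.
From mathcomp Require Import all_boot all_order all_algebra finmap.
From mathcomp Require Import ring lra zify.
From mathcomp Require Import boolp functions.
From mathcomp.multinomials Require Import monalg.

Set Implicit Arguments.
Unset Strict Implicit.
Unset Printing Implicit Defensive.

Import Order.TTheory Order.DefaultSetSubsetOrder GRing.Theory Num.Theory.
Local Open Scope ring_scope.

(** * Exponential generating functions *)

Lemma sum_binS (V : nmodType) (f : nat -> V) n :
  \sum_(i < n.+2) f i *+ 'C(n.+1, i) =
    \sum_(i < n.+1) (f i + f i.+1) *+ 'C(n, i).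
Proof.
under [RHS]eq_bigr do rewrite mulrnDl.
rewrite big_split /= [LHS]big_ord_recl bin0.
under [X in _ + X = _]eq_bigr do rewrite lift0 binS mulrnDr.
rewrite big_split /= addrA; congr (_ + _).
by rewrite big_ord_recr /= bin_small // mulr0n addr0 [RHS]big_ord_recl bin0.
Qed.

(* A sequence [f] stands for the series [\sum_n f n x^n / n!]. *)
Definition egf (R : Type) := nat -> R.

HB.instance Definition _ (R : zmodType) := GRing.Zmodule.copy (egf R) (nat -> R).

Section EgfRing.
Context {R : nzRingType}.
Implicit Types (e f g h : egf R) (a : R).

Definition egfC a : egf R := fun n => if n is 0%N then a else 0.

Definition egf_mul f g : egf R :=
  fun n => \sum_(k < n.+1) (f k * g (n - k)%N) *+ 'C(n, k).

Definition egf_deriv f : egf R := fun n => f n.+1.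

Lemma egfD f g n : (f + g) n = f n + g n.
Proof. by []. Qed.

Lemma egfMn f m n : (f *+ m) n = f n *+ m.
Proof. by elim: m => // m IHm; rewrite !mulrS egfD IHm. Qed.

Lemma egf_derivD : {morph egf_deriv : f g / f + g}.
Proof. by []. Qed.

Lemma egf_mul0 f g : egf_mul f g 0%N = f 0%N * g 0%N.
Proof. by rewrite /egf_mul big_ord1 bin0. Qed.

Lemma egf_mulDl : left_distributive egf_mul +%R.
Proof.
move=> f g h; apply/funext => n; rewrite [RHS]egfD /egf_mul -big_split.
by apply: eq_bigr => k _; rewrite mulrDl mulrnDl.
Qed.

Lemma egf_mulDr : right_distributive egf_mul +%R.
Proof.
move=> f g h; apply/funext => n; rewrite [RHS]egfD /egf_mul -big_split.
by apply: eq_bigr => k _; rewrite mulrDr mulrnDl.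
Qed.

Lemma egf_deriv_mul f g :
  egf_deriv (egf_mul f g) = egf_mul (egf_deriv f) g + egf_mul f (egf_deriv g).
Proof.
apply/funext => n; rewrite [RHS]egfD /egf_deriv /egf_mul.
rewrite (sum_binS (fun k => f k * g (n.+1 - k)%N)) addrC -big_split.
apply: eq_bigr => k _ /=.
by rewrite -mulrnDl subSS -subSn // -ltnS.
Qed.

Lemma egf_mulA : associative egf_mul.
Proof.
move=> f g h; apply/funext => n.
elim: n f g h => [|n IHn] f g h; first by rewrite !egf_mul0 mulrA.
rewrite -[LHS]/(egf_deriv _ n) -[RHS]/(egf_deriv _ n) !egf_deriv_mul.
by rewrite egf_mulDl egf_mulDr !egfD !IHn addrA.
Qed.

Lemma egf_mulCl a f n : egf_mul (egfC a) f n = a * f n.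
Proof.
rewrite /egf_mul big_ord_recl subn0 bin0 big1 ?addr0 // => k _.
by rewrite mul0r mul0rn.
Qed.

Lemma egf_mulCr f a n : egf_mul f (egfC a) n = f n * a.
Proof.
rewrite /egf_mul big_ord_recr /= subnn binn big1 ?add0r // => k _.
have := ltn_ord k; rewrite -subn_gt0; case: (n - k)%N => // m _.
by rewrite mulr0 mul0rn.
Qed.

Lemma egf_mul1l : left_id (egfC 1) egf_mul.
Proof. by move=> f; apply/funext => n; rewrite egf_mulCl mul1r. Qed.

Lemma egf_mul1r : right_id (egfC 1) egf_mul.
Proof. by move=> f; apply/funext => n; rewrite egf_mulCr mulr1. Qed.

Lemma egf_oner_neq0 : egfC 1 != 0.
Proof.
by apply/eqP => /(congr1 (fun f : egf R => f 0%N)) /eqP; apply/negP/oner_neq0.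
Qed.

HB.instance Definition _ := GRing.Zmodule_isNzRing.Build (egf R)
  egf_mulA egf_mul1l egf_mul1r egf_mulDl egf_mulDr egf_oner_neq0.

Lemma egf1 n : (1 : egf R) n = (n == 0%N)%:R.
Proof. by case: n. Qed.

Lemma egfM f g n : (f * g) n = \sum_(k < n.+1) (f k * g (n - k)%N) *+ 'C(n, k).
Proof. by []. Qed.

Lemma egfM0 f g : (f * g) 0%N = f 0%N * g 0%N.
Proof. exact: egf_mul0. Qed.

Lemma egfCM a f n : (egfC a * f) n = a * f n.
Proof. exact: egf_mulCl. Qed.

Lemma egfMC f a n : (f * egfC a) n = f n * a.
Proof. exact: egf_mulCr. Qed.

Lemma egfCB : {morph egfC : a b / a - b}.
Proof. by move=> a b; apply/funext => -[|n]; rewrite // [RHS]subr0. Qed.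

HB.instance Definition _ := GRing.isZmodMorphism.Build R (egf R) egfC egfCB.

Lemma egfC_monoid_morphism : monoid_morphism egfC.
Proof.
split=> // a b; apply/funext => n; rewrite egfCM.
by case: n => //= n; rewrite mulr0.
Qed.

HB.instance Definition _ :=
  GRing.isMonoidMorphism.Build R (egf R) egfC egfC_monoid_morphism.

Lemma egf_deriv1 : egf_deriv 1 = 0.
Proof. by []. Qed.

Lemma egf_derivM f g : egf_deriv (f * g) = egf_deriv f * g + f * egf_deriv g.
Proof. exact: egf_deriv_mul. Qed.

Lemma egf_derivCM a f : egf_deriv (egfC a * f) = egfC a * egf_deriv f.
Proof. by apply/funext => n; rewrite egfCM /egf_deriv egfCM. Qed.

Lemma egf_derivMC f a : egf_deriv (f * egfC a) = egf_deriv f * egfC a.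
Proof. by apply/funext => n; rewrite egfMC /egf_deriv egfMC. Qed.

Lemma egf_lreg_1B e : e 0%N = 0 -> GRing.lreg (1 - e).
Proof.
move=> e0 f g /eqP; rewrite -subr_eq0 -mulrBr mulrBl mul1r subr_eq0 => /eqP fgE.
apply/eqP; rewrite -subr_eq0; move: fgE; move: (f - g) => {f g} h hE.
apply/eqP/funext => n; have [m] := ubnP n; elim: m n => // m IHm n le_nm.
rewrite hE egfM big_ord_recl e0 mul0r mul0rn add0r big1 // => i _.
rewrite IHm ?mulr0 ?mul0rn // lift0.
by have := ltn_ord i; lia.
Qed.

End EgfRing.

Section Riccati.
Context {R : nzRingType} (a b : R).

Definition egf_geom (q : R) : egf R := fun n => if n is m.+1 then q ^+ m else 0.

Lemma egf_deriv_geoml q : egf_deriv (egf_geom q) = 1 + egfC q * egf_geom q.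
Proof.
apply/funext => -[|n]; rewrite egfD egf1 egfCM /= ?mulr0 ?addr0 //.
by rewrite add0r -exprS.
Qed.

Lemma egf_deriv_geomr q : egf_deriv (egf_geom q) = 1 + egf_geom q * egfC q.
Proof.
apply/funext => -[|n]; rewrite egfD egf1 egfMC /= ?mul0r ?addr0 //.
by rewrite add0r -exprSr.
Qed.

Local Notation A := (egfC a).
Local Notation B := (egfC b).
Local Notation e := (egf_geom (a - b)).

Variable X : egf R.
Hypothesis X_fix : X = e + e * B * X.

Lemma riccati0 : X 0%N = 0.
Proof. by rewrite X_fix egfD !egfM0 mul0r mul0r addr0. Qed.

Lemma riccati_geom : (1 - e * B) * X = e.
Proof. by rewrite mulrBl mul1r {1}X_fix addrK. Qed.

Lemma riccati_deriv_unique (P : egf R) :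
  (1 - e * B) * P = egf_deriv e * (1 + B * X) -> egf_deriv X = P.
Proof.
have lregB : GRing.lreg (1 - e * B) by apply: egf_lreg_1B; rewrite egfM0 mul0r.
move=> PE; apply: lregB; rewrite PE mulrBl mul1r {1}X_fix.
by rewrite egf_derivD egf_derivM egf_derivMC addrA addrK mulrDr mulr1 mulrA.
Qed.

Lemma riccati_deriv1 : egf_deriv X = (1 + X * A) * (1 + B * X).
Proof.
apply: riccati_deriv_unique; rewrite mulrA; congr (_ * _).
rewrite mulrDr mulr1 mulrA riccati_geom egf_deriv_geomr rmorphB mulrBr.
by rewrite addrAC -addrA.
Qed.

Lemma riccati_deriv2 : egf_deriv X = (1 + X * B) * (1 + A * X).
Proof.
apply: riccati_deriv_unique; rewrite mulrA [(1 - e * B) * _]mulrDr mulr1.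
rewrite [in X in _ + X]mulrA riccati_geom subrK mul1r egf_deriv_geoml.
rewrite mulrDl mul1r -mulrA [e * _]mulrDr mulr1 [e * (B * X)]mulrA -X_fix.
by rewrite rmorphB mulrBl -addrA [B * X + _]addrC subrK.
Qed.

(* The two expressions of [X'] are exchanged by swapping [a] and [b]; their sum
   only involves [c = a + b] and [d = a b + b a]. *)
Lemma riccati_derivMn2 :
  egf_deriv X *+ 2 = 2 + egfC (a + b) * X + X * egfC (a + b)
    + X * egfC (a * b + b * a) * X.
Proof.
have expand P Q : (1 + X * P) * (1 + Q * X) = 1 + X * P + Q * X + X * (P * Q) * X.
  by rewrite mulrDr mulr1 mulrDl mul1r !mulrA !addrA.
rewrite mulr2n {1}riccati_deriv1 riccati_deriv2 !expand !addrA.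
rewrite (ACl ((1*5)*(7*3)*(2*6)*(4*8))) /=.
by rewrite !(rmorphD, rmorphM) !mulrDl !mulrDr -!mulrDl.
Qed.

Lemma riccati_deriv_deriv :
  egf_deriv (egf_deriv X) =
    (egfC (a + b) + X * egfC (a * b + b * a)) * egf_deriv X.
Proof.
rewrite {1}riccati_deriv2 egf_derivM !egf_derivD egf_deriv1 !add0r.
rewrite egf_derivMC egf_derivCM.
have -> : egf_deriv X * B * (1 + A * X) = (1 + X * A) * B * egf_deriv X.
  rewrite [in LHS]riccati_deriv1 [in RHS]riccati_deriv2 !mulrA; congr (_ * _).
  by rewrite -!mulrA; congr (_ * _); rewrite mulrDl mulrDr mul1r mulr1 mulrA.
rewrite mulrA -mulrDl; congr (_ * _).
rewrite !(rmorphD, rmorphM) !mulrDl !mul1r mulrDr !mulrA addrACA.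
by rewrite [B + A]addrC.
Qed.

End Riccati.

Definition egf_map (R S : nzRingType) (phi : R -> S) (f : egf R) : egf S :=
  phi \o f.

Section EgfMap.
Context {R S : nzRingType} (phi : {rmorphism R -> S}).

Lemma egf_mapB : {morph egf_map phi : f g / f - g}.
Proof. by move=> f g; apply/funext => n; apply: rmorphB. Qed.

HB.instance Definition _ :=
  GRing.isZmodMorphism.Build (egf R) (egf S) (egf_map phi) egf_mapB.

Lemma egf_map_monoid_morphism : monoid_morphism (egf_map phi).
Proof.
split=> [|f g]; apply/funext => n.
  by rewrite egf1 -(rmorph_nat phi) -egf1.
rewrite egfM /egf_map /= egfM rmorph_sum; apply: eq_bigr => k _.
by rewrite rmorphMn rmorphM.
Qed.

HB.instance Definition _ := GRing.isMonoidMorphism.Build (egf R) (egf S)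
  (egf_map phi) egf_map_monoid_morphism.

Lemma egf_mapC a : egf_map phi (egfC a) = egfC (phi a).
Proof. by apply/funext => -[|n] //=; apply: rmorph0. Qed.

Lemma egf_deriv_map f : egf_deriv (egf_map phi f) = egf_map phi (egf_deriv f).
Proof. by []. Qed.

Lemma egf_map_inj : injective phi -> injective (egf_map phi).
Proof.
by move=> phi_inj f g /funeqP fgE; apply/funext => n; apply/phi_inj/fgE.
Qed.

End EgfMap.

Section RiccatiLift.
Context {A R : nzRingType} (phi : {rmorphism A -> R}) (a b : R) (c d : A).
Hypothesis phi_c : phi c = a + b.
Hypothesis phi_d : phi d = a * b + b * a.

Variable X : egf R.
Hypothesis X_fix : X = egf_geom (a - b) + egf_geom (a - b) * egfC b * X.

Lemma riccati_image n : exists F, phi F = X n.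
Proof.
pose image x := exists F, phi F = x.
have imageD x y : image x -> image y -> image (x + y).
  by move=> [F <-] [G <-]; exists (F + G); rewrite rmorphD.
have imageM x y : image x -> image y -> image (x * y).
  by move=> [F <-] [G <-]; exists (F * G); rewrite rmorphM.
have imageMn x k : image x -> image (x *+ k).
  by move=> [F <-]; exists (F *+ k); rewrite rmorphMn.
have image0 : image 0 by exists 0; rewrite rmorph0.
rewrite -[exists _, _]/(image (X n)).
have [m] := ubnP n; elim: m n => // m IHm [|[|n]] le_nm.
- by rewrite (riccati0 X_fix).
- exists 1; rewrite rmorph1 -[X 1%N]/(egf_deriv X 0) (riccati_deriv1 X_fix).
  by rewrite egfM0 !egfD egf1 !egfM0 (riccati0 X_fix) mul0r mulr0 !addr0 mulr1.
rewrite -[X n.+2]/(egf_deriv (egf_deriv X) n) (riccati_deriv_deriv X_fix).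
rewrite mulrDl egfD egfCM egfM; apply/imageD.
  by apply/imageM; [exists c | apply: IHm].
apply: (big_ind image) => // k _; rewrite egfMC; apply/imageMn/imageM.
  by apply/imageM; [apply: IHm; have := ltn_ord k; lia | exists d].
by apply: IHm; have := ltn_ord k; lia.
Qed.

Lemma riccati_lift (Phi : egf A) : injective phi -> egf_map phi Phi = X ->
  egf_deriv Phi *+ 2 = 2 + egfC c * Phi + Phi * egfC c + Phi * egfC d * Phi.
Proof.
move=> phi_inj PhiX; apply: (egf_map_inj phi_inj).
rewrite rmorphMn /= -egf_deriv_map PhiX (riccati_derivMn2 X_fix) -phi_c -phi_d.
by rewrite 3!rmorphD rmorph_nat !rmorphM /= !egf_mapC PhiX.
Qed.

End RiccatiLift.

(** * Splitting words at a letter *)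

Section WordSplit.
Context {R : nzRingType} {I : eqType}.
Implicit Types (x y : I) (f g : seq I -> R) (u v w : seq I).

(* The sum of [f u * g w] over the factorizations [v = u ++ x :: w]. *)
Definition word_split x f g v : R :=
  \sum_(i < size v | nth x v i == x) f (take i v) * g (drop i.+1 v).

Definition word_empty w : R := (w == [::])%:R.

Lemma eq_word_split x f f' g g' v :
    (forall u w, v = u ++ x :: w -> f u * g w = f' u * g' w) ->
  word_split x f g v = word_split x f' g' v.
Proof.
move=> eqfg; apply: eq_bigr => i /eqP vi; apply: eqfg.
by rewrite -{1}vi -drop_nth // cat_take_drop.
Qed.

Lemma word_split_eq0 x f g v :
  (forall u w, v = u ++ x :: w -> f u * g w = 0) -> word_split x f g v = 0.
Proof.
move=> fg0; rewrite (@eq_word_split x f (fun=> 0) g g v) => [|u w /fg0 ->].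
  by apply: big1 => i _; rewrite mul0r.
by rewrite mul0r.
Qed.

Lemma word_split_cons x y f g v :
  word_split x f g (y :: v) =
    (if y == x then f [::] * g v else 0) + word_split x (fun u => f (y :: u)) g v.
Proof. by rewrite /word_split big_mkcond big_ord_recl /= drop0 -big_mkcond. Qed.

Lemma word_split_cat x f g u v :
  word_split x f g (u ++ v) =
    word_split x f (fun w => g (w ++ v)) u + word_split x (fun w => f (u ++ w)) g v.
Proof.
elim: u f => [|y u IHu] f; first by rewrite {2}/word_split big_ord0 add0r.
by rewrite cat_cons !word_split_cons IHu addrA.
Qed.

Lemma sum_word_split (K : Type) (r : seq K) x (F G : K -> seq I -> R) f g v :
    (forall u w, v = u ++ x :: w -> \sum_(k <- r) F k u * G k w = f u * g w) ->
  \sum_(k <- r) word_split x (F k) (G k) v = word_split x f g v.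
Proof.
move=> FGE; rewrite exchange_big; apply: eq_bigr => i /eqP vi /=; apply: FGE.
by rewrite -{1}vi -drop_nth // cat_take_drop.
Qed.

Lemma word_splitBl x f f' g v :
  word_split x (fun u => f u - f' u) g v = word_split x f g v - word_split x f' g v.
Proof. by rewrite -sumrB; apply: eq_bigr => i _; rewrite mulrBl. Qed.

Lemma word_splitBr x f g g' v :
  word_split x f (fun w => g w - g' w) v = word_split x f g v - word_split x f g' v.
Proof. by rewrite -sumrB; apply: eq_bigr => i _; rewrite mulrBr. Qed.

Lemma word_splitZl x a f g v :
  word_split x (fun u => a * f u) g v = a * word_split x f g v.
Proof. by rewrite mulr_sumr; apply: eq_bigr => i _; rewrite mulrA. Qed.

Lemma word_splitMnl x f g m v :
  word_split x (fun u => f u *+ m) g v = word_split x f g v *+ m.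
Proof. by rewrite -sumrMnl; apply: eq_bigr => i _; rewrite mulrnAl. Qed.

Lemma word_split_nseq x y f g n : y != x -> word_split x f g (nseq n y) = 0.
Proof.
move=> neq_yx; apply: big_pred0 => i; apply/negbTE.
by rewrite nth_nseq; have := ltn_ord i; rewrite [X in (_ < X)%N]size_nseq => ->.
Qed.

End WordSplit.

Lemma word_split_ge0 (R : numDomainType) (I : eqType) (x : I)
    (f g : seq I -> R) v :
    (forall u, (size u < size v)%N -> 0 <= f u) ->
    (forall w, (size w < size v)%N -> 0 <= g w) ->
  0 <= word_split x f g v.
Proof.
move=> f_ge0 g_ge0; apply: sumr_ge0 => i _.
rewrite mulr_ge0 ?f_ge0 ?g_ge0 // ?size_drop ?size_take ?ltn_ord //.
by have := ltn_ord i; lia.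
Qed.

Lemma word_split_cons_gt0 (R : numDomainType) (I : eqType) (x : I)
    (f g : seq I -> R) v :
    0 < f [::] -> 0 < g v ->
    (forall u, (size u <= size v)%N -> 0 <= f u) ->
    (forall w, (size w <= size v)%N -> 0 <= g w) ->
  0 < word_split x f g (x :: v).
Proof.
move=> f_gt0 g_gt0 f_ge0 g_ge0; rewrite word_split_cons eqxx.
rewrite ltr_wpDr ?mulr_gt0 // word_split_ge0 // => u lt_uv.
  exact: f_ge0.
exact/g_ge0/ltnW.
Qed.

Lemma word_empty_ge0 (R : numDomainType) (I : eqType) (w : seq I) :
  0 <= word_empty w :> R.
Proof. exact: ler0n. Qed.

Lemma word_split_rev (R : comNzRingType) (I : eqType) (x : I)
    (f g : seq I -> R) v :
  word_split x f g (rev v) = word_split x (fun u => g (rev u)) (fun w => f (rev w)) v.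
Proof.
have subSK (i : 'I_(size v)) : (size v - (size v - i.+1).+1)%N = i.
  by have := ltn_ord i; lia.
rewrite /word_split size_rev (reindex_inj rev_ord_inj) /=.
apply: eq_big => [i | i _].
  by rewrite nth_rev ?subSK //; have := ltn_ord i; lia.
by rewrite take_rev drop_rev subSK subKn // mulrC.
Qed.

Lemma rmorph_word_split (R S : nzRingType) (phi : {rmorphism R -> S})
    (I : eqType) (x : I) (f g : seq I -> R) v :
  phi (word_split x f g v) = word_split x (phi \o f) (phi \o g) v.
Proof. by rewrite rmorph_sum; apply: eq_bigr => i _; rewrite rmorphM. Qed.

(** * The free algebra *)

Section FreeAlgebra.
Context {R : nzRingType} {I : choiceType}.
Local Notation malgW := {malg R[{fmonom I}]}.
Implicit Types (x y : I) (F G : malgW) (u v w : seq I).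

Definition letter x : malgW := << FMonom [:: x] >>.

Definition wcoef F w : R := F@_(FMonom w).

Lemma wcoefE_msupp F v : wcoef F v = \sum_(m <- msupp F) F@_m *+ (m == v :> seq I).
Proof.
rewrite /wcoef {1}(monalgE F) raddf_sum; apply: eq_bigr => m _.
by rewrite /= mcoeffU fmP.
Qed.

Lemma wcoef1 w : wcoef 1 w = word_empty w.
Proof. by rewrite /wcoef mcoeff1 fmP fm1. Qed.

Lemma wcoefM F G v :
  wcoef (F * G) v = \sum_(i < (size v).+1) wcoef F (take i v) * wcoef G (drop i v).
Proof.
have splitE u w : (u ++ w == v) =
    (\sum_(i < (size v).+1) ((u == take i v) && (w == drop i v)))%N :> nat.
  have [<- | neq_v] := eqVneq (u ++ w) v; last first.
    apply/esym/big1 => i _; apply/eqP; rewrite eqb0.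
    by apply: contra neq_v => /andP[/eqP -> /eqP ->]; rewrite cat_take_drop.
  have lt_u : (size u < (size (u ++ w)).+1)%N by rewrite size_cat ltnS leq_addr.
  rewrite (bigD1 (Ordinal lt_u)) //= take_size_cat // drop_size_cat // !eqxx.
  rewrite big1 // => i; apply: contraNeq; rewrite eqb0 negbK => /andP[/eqP uE _].
  by apply/eqP/val_inj; rewrite [RHS](congr1 size uE) size_takel // -ltnS.
rewrite {1}/wcoef mcoeffMl.
under [RHS]eq_bigr => i _ do
  rewrite [wcoef F _]wcoefE_msupp [wcoef G _]wcoefE_msupp mulr_suml.
rewrite [RHS]exchange_big; apply: eq_bigr => u _ /=.
under [RHS]eq_bigr => i _ do rewrite mulr_sumr.
rewrite [RHS]exchange_big; apply: eq_bigr => w _ /=.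
rewrite fmP fmM splitE -sumrMnr; apply: eq_bigr => i _.
by rewrite mulrnAl mulrnAr -mulrnA mulnC mulnb.
Qed.

Lemma wcoef_letter x w : wcoef (letter x) w = (w == [:: x])%:R.
Proof. by rewrite /wcoef mcoeffU1 fmP eq_sym. Qed.

Lemma wcoef_letterM x F w :
  wcoef (letter x * F) w =
    if w is y :: w' then if x == y then wcoef F w' else 0 else 0.
Proof.
rewrite wcoefM; case: w => [|y w]; first by rewrite big_ord1 wcoef_letter mul0r.
rewrite !big_ord_recl !wcoef_letter /= take0 drop0 eqseq_cons andbT mul0r add0r.
rewrite big1 ?addr0 => [|i _].
  by rewrite eq_sym; case: eqP; rewrite ?mul1r ?mul0r.
rewrite wcoef_letter; case: w i => [|z w] i; first by case: i.
by rewrite /= !eqseq_cons andbF mul0r.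
Qed.

Lemma wcoefM_letterM F x G v :
  wcoef (F * letter x * G) v = word_split x (wcoef F) (wcoef G) v.
Proof.
rewrite -mulrA wcoefM big_ord_recr /= drop_size wcoef_letterM mulr0 addr0.
rewrite /word_split [RHS]big_mkcond; apply: eq_bigr => i _.
rewrite (drop_nth x) // wcoef_letterM eq_sym.
by case: ifP; rewrite ?mulr0.
Qed.

Lemma wcoef_letterM_split x F v :
  wcoef (letter x * F) v = word_split x word_empty (wcoef F) v.
Proof.
rewrite -[letter x]mul1r wcoefM_letterM; apply: eq_word_split => u w _.
by rewrite wcoef1.
Qed.

Lemma wcoefM_letter_split F x v :
  wcoef (F * letter x) v = word_split x (wcoef F) word_empty v.
Proof.
rewrite -[F * _]mulr1 wcoefM_letterM; apply: eq_word_split => u w _.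
by rewrite wcoef1.
Qed.

Definition lquot x : malgW -> malgW :=
  mmap malgC (fun m : {fmonom I} =>
    if m : seq I is y :: w then if x == y then << FMonom w >> else 0 else 0).

HB.instance Definition _ x := GRing.Additive.on (lquot x).

Lemma wcoef_lquot x F w : wcoef (lquot x F) w = wcoef F (x :: w).
Proof.
rewrite [RHS]wcoefE_msupp /wcoef /lquot mmapE raddf_sum; apply: eq_bigr => m _ /=.
rewrite mcoeffCM; case: (m : seq I) => [|y u]; first by rewrite mcoeff0 mulr0.
rewrite eqseq_cons [y == x]eq_sym; case: (x == y); last by rewrite mcoeff0 mulr0.
by rewrite mcoeffU1 fmP mulr_natr.
Qed.

Lemma lquot_letterM x y F : lquot x (letter y * F) = if x == y then F else 0.
Proof.
apply/malgP => -[w]; rewrite -!/(wcoef _ w) wcoef_lquot wcoef_letterM eq_sym.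
by case: ifP => //; rewrite /wcoef mcoeff0.
Qed.

Lemma lquotC x c : lquot x c%:MP = 0.
Proof.
by apply/malgP => -[w]; rewrite [LHS]wcoef_lquot mcoeff0 [LHS]mcoeffC fmP fm1 mulr0n.
Qed.

End FreeAlgebra.

Lemma letter_decomposition (R : nzRingType) (I : finType)
    (F : {malg R[{fmonom I}]}) :
  F = (F@_mone)%:MP + \sum_x letter x * lquot x F.
Proof.
apply/malgP => -[w]; rewrite mcoeffD mcoeffC raddf_sum fmP fm1 /=.
under eq_bigr => x _ do rewrite -/(wcoef _ w) wcoef_letterM.
case: w => [|y w]; first by rewrite big1 // addr0 mulr1n -fmoneE.
by rewrite mulr0n add0r -big_mkcond big_pred1_eq wcoef_lquot.
Qed.

Lemma wcoef_egf_letters (R : nzRingType) (I : choiceType) (x y : I)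
    (Phi : egf {malg R[{fmonom I}]}) :
    egf_deriv Phi *+ 2 = 2 + egfC (letter x) * Phi + Phi * egfC (letter x)
      + Phi * egfC (letter y) * Phi ->
  forall n v,
    wcoef (Phi n.+1) v *+ 2 =
      ((n == 0%N) && (v == [::]))%:R *+ 2
        + word_split x word_empty (wcoef (Phi n)) v
        + word_split x (wcoef (Phi n)) word_empty v
        + \sum_(k < n.+1)
            word_split y (wcoef (Phi k)) (wcoef (Phi (n - k)%N)) v *+ 'C(n, k).
Proof.
move=> Phi_deriv n v; rewrite -wcoef_letterM_split -wcoefM_letter_split.
under eq_bigr => k _ do rewrite -wcoefM_letterM -mcoeffMn -egfMC.
rewrite -[in LHS]mcoeffMn.
have -> : Phi n.+1 *+ 2 = (egf_deriv Phi *+ 2) n by rewrite egfMn.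
rewrite Phi_deriv.
rewrite 3!egfD egfCM egfMC egfM egfMn egf1 /wcoef 3!mcoeffD.
congr (_ + _ + _ + _); last exact: raddf_sum.
by rewrite mcoeffMn; case: n => [|n]; rewrite ?mcoeff0 // -/(wcoef _ v) wcoef1.
Qed.

(** * Flags of the Boolean lattice *)

Lemma big_tuple_cons (R : Type) (idx : R) (op : Monoid.com_law idx)
    (T : finType) k (F : seq T -> R) :
  \big[op/idx]_(t : k.+1.-tuple T) F t =
    \big[op/idx]_z \big[op/idx]_(t : k.-tuple T) F (z :: t).
Proof.
rewrite pair_big_dep /=.
rewrite (reindex (fun p : T * k.-tuple T => [tuple of p.1 :: p.2])) //=.
exists (fun t => (thead t, [tuple of behead t])) => [[z t] _ | t _] /=.
  by congr (_, _); apply: val_inj.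
by rewrite [t in RHS]tuple_eta; apply: val_inj.
Qed.

Lemma big_tuple0 (R : Type) (idx : R) (op : Monoid.law idx) (T : finType)
    (F : seq T -> R) :
  \big[op/idx]_(t : 0.-tuple T) F t = F [::].
Proof.
by rewrite (big_pred1 [tuple]) // => t /=; rewrite [t]tuple0; apply/esym/eqP.
Qed.

(* The letters of [t] stand for the ranks [j, ..., j + size t - 1] of a Boolean
   lattice of rank [j + size t]; the chains have one element of each rank whose
   letter is [true], and none of the ranks below [j]. *)
Fixpoint flag_count j (t : seq bool) : nat :=
  if t is x :: t' then
    if x then 'C(j + size t, j) * flag_count 1 t' else flag_count j.+1 t'
  else 1.

Section FlagSum.
Context {R : nzRingType} (a b : R).

Definition flag_sum j r : R :=
  \sum_(t : r.-tuple bool)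
     (\prod_(x <- t) (if x then b else a - b)) *+ flag_count j t.

Lemma flag_sum0 j : flag_sum j 0 = 1.
Proof.
rewrite /flag_sum (big_tuple0 _ (fun t =>
  (\prod_(x <- t) (if x then b else a - b)) *+ flag_count j t)).
by rewrite big_nil.
Qed.

Lemma flag_sumS j r :
  flag_sum j r.+1 =
    (a - b) * flag_sum j.+1 r + (b * flag_sum 1 r) *+ 'C(j + r.+1, j).
Proof.
rewrite /flag_sum (big_tuple_cons _ r (fun t =>
  (\prod_(x <- t) (if x then b else a - b)) *+ flag_count j t)).
rewrite big_bool [LHS]addrC !mulr_sumr -sumrMnl; congr (_ + _); apply: eq_bigr => t _.
  by rewrite big_cons mulrnAr.
by rewrite big_cons mulrnAr -mulrnA mulnC /= size_tuple.
Qed.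

Lemma flag_sum_unroll j r :
  flag_sum j r = (a - b) ^+ r
    + \sum_(i < r) ((a - b) ^+ i * b * flag_sum 1 (r - i.+1)) *+ 'C(j + r, j + i).
Proof.
elim: r j => [|r IHr] j; first by rewrite flag_sum0 big_ord0 addr0.
rewrite flag_sumS IHr mulrDr -exprS -addrA; congr (_ + _).
rewrite big_ord_recl expr0 mul1r addn0 subn1 addrC; congr (_ + _).
rewrite mulr_sumr; apply: eq_bigr => i _.
by rewrite mulrnAr lift0 !addSnnS subSS exprS !mulrA.
Qed.

Definition ab_egf : egf R := fun n => if n is r.+1 then flag_sum 1 r else 0.

Lemma ab_egf_fix :
  ab_egf = egf_geom (a - b) + egf_geom (a - b) * egfC b * ab_egf.
Proof.
apply/funext => -[|n]; rewrite egfD.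
  by rewrite egfM0 mulr0 addr0.
rewrite [LHS]/= flag_sum_unroll egfM; congr (_ + _).
rewrite big_ord_recl big_ord_recr egfMC /= !mul0r subnn mulr0 !mul0rn add0r addr0.
apply: eq_bigr => i _; rewrite egfMC /= /bump /= subSS !add1n.
by rewrite -(subnSK (ltn_ord i)).
Qed.

End FlagSum.

Lemma prodrMz (R : pzRingType) (I : Type) (s : seq I) (P : pred I) (F : I -> R)
    (z : I -> int) :
  \prod_(i <- s | P i) (F i *~ z i) =
    (\prod_(i <- s | P i) F i) *~ \prod_(i <- s | P i) z i.
Proof.
elim/big_rec3: _ => [|i x y t _ ->]; first by rewrite mulr1z.
by rewrite mulrzAl mulrzAr mulrzA_C.
Qed.

Lemma prod_subset_sign (I : finType) (T S : {set I}) :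
  \prod_i (if i \in T then (i \in S)%:R else (-1) ^+ (i \in S)) =
    if T \subset S then (-1) ^+ #|S :\: T| else 0 :> int.
Proof.
have [sTS | /subsetPn[i iT iS]] := ifPn; last first.
  by rewrite (bigD1 i) //= iT (negPf iS) mul0r.
rewrite -prodr_const [RHS]big_mkcond; apply: eq_bigr => i _; rewrite in_setD.
by have [/(subsetP sTS) -> | _] := boolP (i \in T); case: (i \in S).
Qed.

Lemma sum_supersets_prod (R : nzRingType) (a b : R) (I : finType) (T : {set I}) :
  \sum_(S : {set I} | T \subset S)
      (\prod_i (if i \in S then b else a)) *~ (-1) ^+ #|S :\: T| =
    \prod_i (if i \in T then b else a - b).
Proof.
pose inS i := if i \in T then b else - b.
pose notinS i := if i \in T then 0 else a.
transitivity (\prod_i (inS i + notinS i)); last first.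
  by apply: eq_bigr => i _; rewrite /inS /notinS; case: ifP; rewrite ?addr0 // addrC.
rewrite bigA_distr big_mkcond; apply: eq_bigr => S _.
transitivity (\prod_i ((if i \in S then b else a) *~
    (if i \in T then (i \in S)%:R else (-1) ^+ (i \in S)))).
  by rewrite prodrMz prod_subset_sign; case: ifP; rewrite ?mulr0z.
apply: eq_bigr => i _; rewrite /inS /notinS.
by case: (i \in S); case: (i \in T); rewrite ?mulr1z ?mulr0z ?mulrN1z.
Qed.

Lemma sum_alternating_prod (R : nzRingType) (a b : R) (I : finType)
    (f : {set I} -> int) :
  \sum_(S : {set I}) (\prod_i (if i \in S then b else a)) *~
      (\sum_(T : {set I} | T \subset S) (-1) ^+ #|S :\: T| * f T) =
  \sum_(T : {set I}) (\prod_i (if i \in T then b else a - b)) *~ f T.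
Proof.
under eq_bigr do rewrite mulrz_sumr.
rewrite (exchange_big_dep predT) //=; apply: eq_bigr => T _.
rewrite -sum_supersets_prod mulrz_suml; apply: eq_bigr => S _.
by rewrite mulrzA.
Qed.

Lemma map_succ_enum_set r (t : r.-tuple bool) :
  [seq (val i).+1 | i <- enum [set i | tnth t i]] = mask t (iota 1 r).
Proof.
have -> : enum [set i | tnth t i] = mask t (enum 'I_r).
  rewrite -[in RHS](map_tnth_enum t) -filter_mask enumT.
  by apply: eq_filter => i; rewrite !inE.
by rewrite map_mask (map_comp S val) val_enum_ord -[in RHS](addn0 1%N) iotaDl.
Qed.

Lemma le_boolean n (x y : boolean_lattice n) : (x <= y)%O = (x \subset y).
Proof. by []. Qed.

Lemma lt_boolean n (x y : boolean_lattice n) : (x < y)%O = (x \proper y).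
Proof. by rewrite lt_leAnge !le_boolean properE. Qed.

Lemma card_chain_le n (x : boolean_lattice n) (C : {set boolean_lattice n}) :
    (forall y, y \in C -> (y <= x)%O) ->
    (forall y z, y \in C -> z \in C -> (y >=< z)%O) ->
  (#|C| <= #|x|.+1)%N.
Proof.
move=> C_le C_chain; pose card_C (y : boolean_lattice n) := #|y|.
have card_inj : {in C &, injective card_C}.
  move=> y z Cy Cz eq_yz; apply/eqP.
  have /orP[] := C_chain y z Cy Cz; rewrite le_boolean => syz.
    by rewrite eqEcard syz -/(card_C z) -eq_yz leqnn.
  by rewrite eq_sym eqEcard syz -/(card_C y) eq_yz leqnn.
rewrite cardE -(size_map card_C) -(size_iota 0 #|x|.+1).
apply: uniq_leq_size => [|k /mapP[y]].
  by rewrite map_inj_in_uniq ?enum_uniq // => y z; rewrite !mem_enum; apply: card_inj.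
rewrite mem_enum => /C_le; rewrite le_boolean => /subset_leq_card le_yx ->.
by rewrite mem_iota ltnS.
Qed.

Lemma exists_maximal_chain n (x : boolean_lattice n) :
  exists C : {set boolean_lattice n},
    [/\ forall y, y \in C -> (y <= x)%O,
        forall y z, y \in C -> z \in C -> (y >=< z)%O & #|C| = #|x|.+1].
Proof.
pose y_ (k : nat) : boolean_lattice n := [set i in take k (enum x)].
have y_mono k l : (k <= l)%N -> (y_ k <= y_ l)%O.
  move=> le_kl; rewrite le_boolean; apply/subsetP => i; rewrite !inE => ik.
  by rewrite -(subnKC le_kl) takeD mem_cat ik.
have card_y k : (k <= #|x|)%N -> #|y_ k| = k.
  move=> le_kx; rewrite cardsE (card_uniqP _) ?take_uniq ?enum_uniq //.
  by rewrite size_takel // -cardE.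
exists [set y_ k | k : 'I_#|x|.+1]; split.
- move=> _ /imsetP[k _ ->]; rewrite le_boolean.
  by apply/subsetP => i; rewrite inE => /mem_take; rewrite mem_enum.
- move=> _ _ /imsetP[k _ ->] /imsetP[l _ ->]; rewrite /Order.comparable.
  by case: (leqP k l) => [|/ltnW] /y_mono ->; rewrite ?orbT.
rewrite card_imset ?card_ord // => k l /(congr1 (fun y : {set 'I_n} => #|y|)).
by rewrite !card_y -1?ltnS ?ltn_ord // => /val_inj.
Qed.

Lemma rank_boolean n (x : boolean_lattice n) : rank x = #|x|.
Proof.
rewrite /rank; set m := (\max_(_ | _) _); suff -> : m = #|x|.+1 by [].
apply/eqP; rewrite eqn_leq; apply/andP; split.
  apply/bigmax_leqP => C /andP[/forall_inP C_le /forall_inP C_chain].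
  apply: card_chain_le => // y z Cy Cz.
  by move/forall_inP: (C_chain y Cy); apply.
have [C [C_le C_chain <-]] := exists_maximal_chain x.
apply: (leq_bigmax_cond (F := fun C : {set boolean_lattice n} => #|C|)).
apply/andP; split; first by apply/forall_inP => y /C_le.
by apply/forall_inP => y Cy; apply/forall_inP => z; apply: C_chain.
Qed.

Lemma card_proper_supersets n (y : {set 'I_n}) j : (0 < j)%N ->
  #|[set z : {set 'I_n} | y \proper z & #|z| == #|y| + j]| = 'C(n - #|y|, j).
Proof.
move=> j_gt0.
have -> : (n - #|y| = #|~: y|)%N by rewrite [RHS]cardsCs setCK card_ord.
have setUKy : {in [set B : {set 'I_n} | B \subset ~: y & #|B| == j],
    cancel (setU y) (fun z => z :\: y)}.
  move=> B; rewrite inE => /andP[sBy _].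
  by rewrite setDUl setDv set0U setDE (setIidPl sBy).
rewrite -cards_draws -(card_in_imset (can_in_inj setUKy)).
apply: eq_card => z; rewrite inE; apply/andP/imsetP => [[yz /eqP zr] | [B]].
  exists (z :\: y); last first.
    by rewrite setDE setUIr setUCr setIT; apply/esym/setUidPr/proper_sub.
  by rewrite inE subDset setUCr subsetT cardsDS ?proper_sub // zr addKn eqxx.
rewrite inE => /andP[sBy /eqP cardB] ->.
have yB0 : y :&: B = set0.
  by apply/eqP; rewrite setI_eq0 disjoint_sym disjoints_subset.
have cardyB : #|y :|: B| = (#|y| + j)%N by rewrite cardsU yB0 cards0 subn0 cardB.
by rewrite properEcard subsetUl cardyB eqxx -[X in (X < _)%N]addn0 ltn_add2l.
Qed.

Lemma sum_chains_boolean n k p j (t : seq bool) (y : boolean_lattice n) :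
    count id t = k -> #|y| = p -> (0 < j)%N -> (p + j + size t)%N = n ->
  (\sum_(s : k.-tuple (boolean_lattice n))
     (path <%O y (rcons s \top%O) &&
      ([seq rank z | z <- s] == mask t (iota (p + j) (size t)))))%N =
    flag_count j t.
Proof.
elim: t k p j y => [|x t IHt] k p j y /= countE cardy j_gt0 nE.
  rewrite -countE (big_tuple0 _ (fun s => nat_of_bool
    (path <%O y (rcons s \top%O) && ([seq rank z | z <- s] == [::])))) /=.
  rewrite !andbT lt_boolean -[\top%O]/[set: 'I_n] properEcard subsetT cardsT card_ord.
  by rewrite cardy; have -> : (p < n)%N by lia.
case: x countE => countE; last first.
  by rewrite -addnS; apply: IHt => //; lia.
rewrite -countE (big_tuple_cons _ _ (fun s => nat_of_bool
  (path <%O y (rcons s \top%O) &&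
   ([seq rank z | z <- s] == (p + j)%N :: mask t (iota (p + j).+1 (size t)))))) /=.
rewrite (bigID (fun z => (y < z)%O && (rank z == p + j)%N)) /=.
rewrite [X in (_ + X)%N]big1 ?addn0 => [|z not_next]; last first.
  rewrite big1 // => s _; rewrite eqseq_cons; apply/eqP; rewrite eqb0.
  by apply: contra not_next => /andP[/andP[-> _] /andP[-> _]].
rewrite (eq_bigr (fun=> flag_count 1 t)) => [|z /andP[lt_yz /eqP rank_z]].
  have -> : (j + (size t).+1 = n - p)%N by lia.
  rewrite sum_nat_const -cardy -card_proper_supersets //.
  congr (_ * _)%N; apply: eq_card => z.
  by rewrite [RHS]inE unfold_in lt_boolean rank_boolean.
rewrite -(IHt _ (p + j)%N 1%N z erefl) -?rank_boolean //; last by lia.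
by apply: eq_bigr => s _; rewrite eqseq_cons lt_yz rank_z eqxx addn1.
Qed.

Lemma flag_f_boolean r (t : r.-tuple bool) :
  flag_f (P := boolean_lattice r.+1) [set i | tnth t i] = flag_count 1 t.
Proof.
have countE : count id t = #|[set i | tnth t i]|.
  rewrite cardE -(size_map (S \o val)) map_succ_enum_set.
  by rewrite size_mask ?size_iota ?size_tuple.
have bottom0 : #|\bot%O : boolean_lattice r.+1| = 0%N by apply: cards0.
rewrite -(sum_chains_boolean countE bottom0) ?size_tuple //.
rewrite /flag_f -sum1_card big_mkcond /=; apply: eq_bigr => s _.
by rewrite inE map_succ_enum_set; case: (_ && _).
Qed.

Lemma ab_indexE disp (P : finTBPOrderType disp) r : (rank (\top%O : P)).-1 = r ->
  ab_index P =
    \sum_(S : {set 'I_r}) flag_h (P := P) S *: \prod_(i < r) ncvar (i \in S).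
Proof. by move=> <-. Qed.

Lemma ab_index_boolean n :
  ab_index (boolean_lattice n.+1) =
    ab_egf (letter false) (letter true) n.+1 :> ncpoly.
Proof.
rewrite (@ab_indexE _ _ n); last first.
  by rewrite rank_boolean -[\top%O]/[set: 'I_n.+1] cardsT card_ord.
transitivity (\sum_(S : {set 'I_n})
    (\prod_(i < n) (if i \in S then letter true else letter false : ncpoly))
      *~ flag_h (P := boolean_lattice n.+1) S).
  apply: eq_bigr => S _; rewrite -scaler_int intz; congr (_ *: _).
  by apply: eq_bigr => i _; case: (i \in S).
rewrite sum_alternating_prod /= /flag_sum.
rewrite (reindex (fun t : n.-tuple bool => [set i | tnth t i])) /=; last first.
  exists (fun S : {set 'I_n} => [tuple i \in S | i < n]) => [t _ | S _].
    by apply: eq_from_tnth => i; rewrite tnth_mktuple inE.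
  by apply/setP => i; rewrite inE tnth_mktuple.
apply: eq_bigr => t _; rewrite flag_f_boolean pmulrn; congr (_ *~ _).
by rewrite big_tuple; apply: eq_bigr => i _; rewrite inE.
Qed.

(** * The cd-index of the Boolean lattices *)

Lemma ab_independent (A : nzRingType) (a b : A) (quot_a quot_b : {additive A -> A}) :
    (forall F, quot_a (a * F) = F) -> (forall F, quot_a (b * F) = 0) ->
    (forall F, quot_b (a * F) = 0) -> (forall F, quot_b (b * F) = F) ->
  forall k F G, quot_a k = 0 -> quot_b k = 0 ->
    k + ((a * b + b * a) * G + (a + b) * F) = 0 -> [/\ k = 0, G = 0 & F = 0].
Proof.
move=> qaa qab qba qbb k F G qak qbk; rewrite !mulrDl -!mulrA => eq0.
have quot_a0 : b * G + F = 0.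
  have := congr1 quot_a eq0.
  by rewrite !raddfD raddf0 qak !qaa !qab add0r !addr0.
have quot_b0 : a * G + F = 0.
  have := congr1 quot_b eq0.
  by rewrite !raddfD raddf0 qbk !qba !qbb !add0r.
have G0 : G = 0.
  have : b * G = a * G by apply: (addIr F); rewrite quot_a0.
  by move/(congr1 quot_b); rewrite qbb qba.
have F0 : F = 0 by move: quot_a0; rewrite G0 mulr0 add0r.
by move: eq0; rewrite G0 F0 !mulr0 !addr0.
Qed.

Definition cd_letter (x : bool) : ncpoly :=
  if x then letter false * letter true + letter true * letter false
  else letter false + letter true.

Definition cd_monomial (m : {fmonom bool}) : ncpoly :=
  \prod_(x <- (m : seq bool)) cd_letter x.

Lemma cd_monomial_mmorphism : mmorphism cd_monomial.
Proof.
by split=> [m m'|]; rewrite /cd_monomial ?fmM ?big_cat // fm1 big_nil.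
Qed.

HB.instance Definition _ :=
  isMultiplicative.Build {fmonom bool} ncpoly cd_monomial cd_monomial_mmorphism.

Lemma cd_evalE F : cd_eval F = mmap malgC cd_monomial F.
Proof.
by rewrite /cd_eval mmapE; apply: eq_bigr => m _; rewrite mul_malgC.
Qed.

Lemma cd_evalB : {morph cd_eval : F G / F - G}.
Proof. by move=> F G; rewrite !cd_evalE raddfB. Qed.

HB.instance Definition _ := GRing.isZmodMorphism.Build ncpoly ncpoly cd_eval cd_evalB.

Lemma cd_eval_monoid_morphism : monoid_morphism cd_eval.
Proof.
have comm_const (F : ncpoly) m m' : GRing.comm (F@_m)%:MP (cd_monomial m').
  by rewrite -[F@_m]intz rmorph_int; apply/commr_sym/commr_int.
have [mmapM mmap1] := commr_mmap_is_multiplicative comm_const.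
by split=> [|F G]; rewrite !cd_evalE; [apply: mmap1 | apply: mmapM].
Qed.

HB.instance Definition _ :=
  GRing.isMonoidMorphism.Build ncpoly ncpoly cd_eval cd_eval_monoid_morphism.

Lemma cd_evalC (n : int) : cd_eval n%:MP = n%:MP.
Proof. by rewrite -[n]intz rmorph_int rmorph_int. Qed.

Lemma cd_eval_letter x : cd_eval (letter x) = cd_letter x.
Proof. by rewrite cd_evalE mmapU mul1r /cd_monomial big_seq1. Qed.

Lemma cd_eval_eq0 F : cd_eval F = 0 ->
  wcoef F [::] = 0 /\ forall x, cd_eval (lquot x F) = 0.
Proof.
rewrite {1}(letter_decomposition F) rmorphD rmorph_sum /= cd_evalC.
under eq_bigr => x _ do rewrite rmorphM /= cd_eval_letter.
rewrite big_bool => cdF0.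
case: (ab_independent (quot_a := lquot false) (quot_b := lquot true)
  _ _ _ _ _ _ cdF0).
- exact: (lquot_letterM false false).
- exact: (lquot_letterM false true).
- exact: (lquot_letterM true false).
- exact: (lquot_letterM true true).
- exact: lquotC.
- exact: lquotC.
move=> /(congr1 (mcoeff mone)); rewrite mcoeff0 mcoeffUU => const0 quot_d0 quot_c0.
split; first by rewrite /wcoef -fmoneE; exact: const0.
by case; [exact: quot_d0 | exact: quot_c0].
Qed.

Lemma cd_eval_inj : injective cd_eval.
Proof.
apply: raddf_inj => F F_eq0; apply/malgP => -[w]; rewrite mcoeff0 -/(wcoef F w).
elim: w F F_eq0 => [|x w IHw] F /cd_eval_eq0[const0 quot0]; first exact: const0.
by rewrite -wcoef_lquot; apply: IHw.
Qed.

Definition boolean_cd_egf : egf ncpoly :=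
  fun n => if n is 0%N then 0 else cd_index (boolean_lattice n).

Lemma cd_eval_boolean :
  egf_map cd_eval boolean_cd_egf = ab_egf (letter false) (letter true).
Proof.
apply/funext => -[|n]; first exact: rmorph0.
rewrite -ab_index_boolean; apply: (epsilon_spec (inhabits (0 : ncpoly))
  (fun F => cd_eval F = ab_index (boolean_lattice n.+1))).
rewrite ab_index_boolean.
exact: (riccati_image (cd_eval_letter false) (cd_eval_letter true) (ab_egf_fix _ _)).
Qed.

Lemma boolean_cd_egf_derivMn2 :
  egf_deriv boolean_cd_egf *+ 2 =
    2 + egfC (letter false) * boolean_cd_egf + boolean_cd_egf * egfC (letter false)
      + boolean_cd_egf * egfC (letter true) * boolean_cd_egf.
Proof.
exact: (riccati_lift (cd_eval_letter false) (cd_eval_letter true)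
  (ab_egf_fix _ _) cd_eval_inj cd_eval_boolean).
Qed.

Lemma cd_degree_nil : cd_degree [::] = 0%N.
Proof. by rewrite /cd_degree big_nil. Qed.

Lemma cd_degree_cons x v :
  cd_degree (x :: v) = ((if x then 2 else 1) + cd_degree v)%N.
Proof. by rewrite /cd_degree big_cons. Qed.

Lemma cd_degree_cat u v : cd_degree (u ++ v) = (cd_degree u + cd_degree v)%N.
Proof. by rewrite /cd_degree big_cat. Qed.

Lemma cd_degree_rev v : cd_degree (rev v) = cd_degree v.
Proof. by rewrite /cd_degree (perm_big v) //= perm_rev. Qed.

Lemma cd_degree_nseq n : cd_degree (nseq n false) = n.
Proof. by elim: n => [|n IHn] /=; rewrite ?cd_degree_nil // cd_degree_cons IHn. Qed.

Definition cd_degreeE :=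
  (cd_degree_nil, cd_degree_cons, cd_degree_cat, cd_degree_rev, cd_degree_nseq).

Lemma cd_degree_split v u x w : v = u ++ x :: w ->
  cd_degree v = (cd_degree u + cd_degree w + if x then 2 else 1)%N.
Proof. by move=> ->; rewrite cd_degree_cat cd_degree_cons addnCA addnC. Qed.

Lemma factr_neq0 (R : numDomainType) n : n`!%:R != 0 :> R.
Proof. by rewrite pnatr_eq0 -lt0n fact_gt0. Qed.

Section NormalizedCoefficients.
Context {R : numFieldType} (coef : nat -> seq bool -> R).
Hypothesis coef0 : forall v, coef 0 v = 0.
Hypothesis coef_rec : forall n v,
  coef n.+1 v *+ 2 =
    ((n == 0%N) && (v == [::]))%:R *+ 2
      + word_split false word_empty (coef n) v
      + word_split false (coef n) word_empty v
      + \sum_(k < n.+1) word_split true (coef k) (coef (n - k)%N) v *+ 'C(n, k).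

Lemma coef_homogeneous n v : (cd_degree v).+1 != n -> coef n v = 0.
Proof.
have [m] := ubnP n; elim: m n v => // m IHm [|n] v le_nm neq_vn; first exact: coef0.
apply/eqP; have /= <- := mulrn_eq0 (coef n.+1 v) 2; apply/eqP; rewrite coef_rec.
have -> : (n == 0%N) && (v == [::]) = false.
  by apply: contraNF neq_vn => /andP[/eqP -> /eqP ->]; rewrite cd_degree_nil.
rewrite !word_split_eq0 ?big1 ?mul0rn ?addr0 // => [k _|u w vE|u w vE].
- rewrite word_split_eq0 ?mul0rn // => u w vE.
  have [uE | neq_uk] := eqVneq (cd_degree u).+1 k; last first.
    by rewrite (IHm k) ?mul0r //; have := ltn_ord k; lia.
  rewrite (IHm (n - k)%N w) ?mulr0 //; first by lia.
  by move: neq_vn; rewrite vE !cd_degreeE; have := ltn_ord k; lia.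
- rewrite /word_empty; case: w vE => [|y w] vE; last by rewrite mulr0.
  by rewrite IHm ?mul0r //; move: neq_vn; rewrite vE !cd_degreeE; lia.
- rewrite /word_empty; case: u vE => [|y u] vE; last by rewrite mul0r.
  by rewrite IHm ?mulr0 //; move: neq_vn; rewrite vE !cd_degreeE; lia.
Qed.

Definition normalized_coef v : R :=
  coef (cd_degree v).+1 v / ((cd_degree v).+1)`!%:R.

Lemma coef_normalized n v : (cd_degree v).+1 = n ->
  coef n v = n`!%:R * normalized_coef v.
Proof. by move=> <-; rewrite mulrC divfK // factr_neq0. Qed.

Lemma sum_word_split_coef n v : cd_degree v = n ->
  \sum_(k < n.+1) word_split true (coef k) (coef (n - k)%N) v *+ 'C(n, k) =
    n`!%:R * word_split true normalized_coef normalized_coef v.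
Proof.
move=> vn; rewrite -word_splitZl; under eq_bigr => k _ do rewrite -word_splitMnl.
apply: sum_word_split => u w /cd_degree_split; rewrite vn => nE.
have lt_un : ((cd_degree u).+1 < n.+1)%N by lia.
rewrite (bigD1 (Ordinal lt_un)) //= big1 ?addr0 => [|k neq_ku]; last first.
  rewrite coef_homogeneous ?mul0rn ?mul0r //; apply: contra neq_ku => /eqP kE.
  exact/eqP/val_inj.
rewrite (@coef_normalized _ u erefl) (@coef_normalized _ w); last by lia.
have le_un : ((cd_degree u).+1 <= n)%N by lia.
by rewrite -(bin_fact le_un) !natrM -mulr_natr; ring.
Qed.

Lemma normalized_coef_rec v :
  2 * (cd_degree v).+1%:R * normalized_coef v =
    2 * word_empty v
      + word_split false word_empty normalized_coef v
      + word_split false normalized_coef word_empty v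
      + word_split true normalized_coef normalized_coef v.
Proof.
move nE : (cd_degree v) => n; apply: (mulfI (factr_neq0 R n)).
have -> : n`!%:R * (2 * n.+1%:R * normalized_coef v) = coef n.+1 v *+ 2.
  by rewrite (@coef_normalized n.+1 v) ?nE // factS natrM -mulr_natr; ring.
rewrite coef_rec (sum_word_split_coef nE) !mulrDr; congr (_ + _ + _ + _).
- rewrite mulrCA -mulr_natr mulrC /word_empty.
  have [v0 | _] := eqVneq v [::]; last by rewrite andbF !mulr0.
  by rewrite -nE v0 cd_degree_nil mul1r.
- rewrite -word_splitZl; apply: eq_word_split => -[|x u] w /cd_degree_split vE.
    rewrite /word_empty eqxx mul1r mulr1 (@coef_normalized n w) // -nE vE.
    by rewrite cd_degree_nil addn1.
  by rewrite /word_empty mulr0 !mul0r.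
- rewrite -word_splitZl; apply: eq_word_split => u [|x w] /cd_degree_split vE.
    by rewrite (@coef_normalized n u) // -nE vE cd_degree_nil addn0 addn1.
  by rewrite /word_empty !mulr0.
Qed.

End NormalizedCoefficients.

Definition normalized_beta : seq bool -> rat :=
  normalized_coef (fun n v => (wcoef (boolean_cd_egf n) v)%:~R).

Lemma normalized_betaE v :
  normalized_beta v = (cd_coef_boolean v)%:~R / ((cd_degree v).+1)`!%:R.
Proof. by []. Qed.

Lemma normalized_beta_rec v :
  2 * (cd_degree v).+1%:R * normalized_beta v =
    2 * word_empty v
      + word_split false word_empty normalized_beta v
      + word_split false normalized_beta word_empty v
      + word_split true normalized_beta normalized_beta v.
Proof.
apply: normalized_coef_rec => {v} [v | n v].
  by rewrite /wcoef mcoeff0.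
have intr_empty w : (word_empty w)%:~R = word_empty w :> rat.
  by rewrite /word_empty rmorph_nat.
rewrite -rmorphMn (wcoef_egf_letters boolean_cd_egf_derivMn2) 3!rmorphD.
congr (_ + _ + _ + _).
- by rewrite rmorphMn rmorph_nat.
- rewrite /= (rmorph_word_split intr); apply: eq_word_split => u w _.
  by rewrite /= intr_empty.
- rewrite /= (rmorph_word_split intr); apply: eq_word_split => u w _.
  by rewrite /= intr_empty.
rewrite rmorph_sum; apply: eq_bigr => k _.
by rewrite rmorphMn /= (rmorph_word_split intr).
Qed.

(** * Inequalities and binomial identities *)

Section BalancedPairs.
Context {R : realDomainType}.
Implicit Types (s m n : nat).

Lemma prod_lt_of_ratio_lt (f g : nat -> R) m n t :
    (forall k, 0 < f k) -> (forall k, 0 < g k) ->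
    (forall k l, (k < l)%N -> f k * g l.+1 < f k.+1 * g l) ->
  (m < n)%N -> (0 < t)%N -> f m * g (n + t)%N < f (m + t)%N * g n.
Proof.
move=> f_gt0 g_gt0 ratio_lt lt_mn; case: t => // t _.
elim: t => [|t IHt]; first by rewrite !addn1 ratio_lt.
rewrite !(addnS _ t.+1) -(ltr_pM2l (f_gt0 (m + t.+1)%N)).
apply: (@lt_trans _ _ (f m * (f (m + t.+1).+1 * g (n + t.+1)%N))).
  by rewrite mulrCA ltr_pM2l // ratio_lt; lia.
by rewrite mulrCA [X in _ < X]mulrCA ltr_pM2l.
Qed.

Lemma prod_lt_of_balanced (f g : nat -> R) m1 n1 m2 n2 :
    (forall k, 0 < f k) -> (forall k, 0 < g k) ->
    (forall k l, (k < l)%N -> f k * g l.+1 < f k.+1 * g l) ->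
    (forall k l, (k < l)%N -> g k * f l.+1 < g k.+1 * f l) ->
    (m1 + n1 = m2 + n2)%N -> (minn m2 n2 < minn m1 n1)%N ->
  f m2 * g n2 < f m1 * g n1.
Proof.
move=> f_gt0 g_gt0 ratio_fg ratio_gf eq_sum lt_min.
have [lt_mn | le_nm] := ltnP m2 n2.
  have := prod_lt_of_ratio_lt (m := m2) (n := n1) (t := m1 - m2) f_gt0 g_gt0 ratio_fg.
  have [-> ->] : (m2 + (m1 - m2) = m1 /\ n1 + (m1 - m2) = n2)%N by lia.
  by apply; lia.
have := prod_lt_of_ratio_lt (m := n2) (n := m1) (t := n1 - n2) g_gt0 f_gt0 ratio_gf.
have [-> ->] : (n2 + (n1 - n2) = n1 /\ m1 + (n1 - n2) = m2)%N by lia.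
by rewrite ![g _ * _]mulrC; apply; lia.
Qed.

Lemma lt_of_balanced s (f : nat -> nat -> R) :
    (forall m n, (m < n)%N -> (m + n = s)%N -> f m n <= f n m) ->
    (forall m n, (m < n)%N -> (m.+1 + n = s)%N -> f n.+1 m < f m.+1 n) ->
  forall m1 n1 m2 n2, (m1 + n1 = s)%N -> (m2 + n2 = s)%N ->
    (minn m2 n2 < minn m1 n1)%N -> f m2 n2 < f m1 n1.
Proof.
move=> f_flip f_shift m1 n1 m2 n2 s1 s2.
have f_chain k l : (k < l)%N -> (2 * l <= s)%N -> f (s - k)%N k < f l (s - l)%N.
  elim: l => // l IHl; rewrite ltnS => le_kl le_ls.
  have f_step : f (s - l)%N l < f l.+1 (s - l.+1)%N.
    by have -> : (s - l = (s - l.+1).+1)%N by [lia]; apply: f_shift; lia.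
  have [-> // | neq_kl] := eqVneq k l.
  apply: lt_trans (IHl _ _) _; try lia.
  by apply: le_lt_trans f_step; apply: f_flip; lia.
have f_le m n : (m + n = s)%N -> f m n <= f (s - minn m n)%N (minn m n).
  move=> sE; have [lt_mn | le_nm] := ltnP m n; last by rewrite -sE addnK.
  by rewrite -sE addKn; apply: f_flip.
have f_ge m n : (m + n = s)%N -> f (minn m n) (s - minn m n)%N <= f m n.
  move=> sE; have [le_mn | lt_nm] := leqP m n; first by rewrite -sE addKn.
  by rewrite -sE addnK; apply: f_flip => //; rewrite addnC.
move=> lt_min; apply: le_lt_trans (f_le _ _ s2) _; apply: lt_le_trans (f_ge _ _ s1).
by apply: f_chain; lia.
Qed.

End BalancedPairs.

Lemma discrete_min_principle (R : realDomainType) (c : R) L (f : nat -> R) :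
    0 < c ->
    (forall i, (i <= L)%N ->
       i%:R * f i.-1 + (L - i)%:R * f i.+1 <= (c + L%:R) * f i) ->
  forall i, (i <= L)%N -> 0 <= f i.
Proof.
move=> c_gt0 f_super i le_iL.
have [j _ f_min] := arg_minP (fun k : 'I_L.+1 => f k) (isT : predT (ord0 : 'I_L.+1)).
have f_ge k : (k <= L)%N -> f j <= f k.
  by rewrite -ltnS => lt_kL; apply: (f_min (Ordinal lt_kL)).
have le_jL : (j <= L)%N by rewrite -ltnS.
apply: le_trans (f_ge i le_iL).
have le_left : j%:R * f j <= j%:R * f j.-1.
  by case: (posnP j) => [-> | j_gt0]; rewrite ?mul0r // ler_wpM2l // f_ge; lia.
have le_right : (L - j)%:R * f j <= (L - j)%:R * f j.+1.
  by case: (posnP (L - j)) => [-> | j_ltL]; rewrite ?mul0r // ler_wpM2l // f_ge; lia.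
rewrite -(pmulr_rge0 _ c_gt0); have := f_super j le_jL.
by rewrite -[X in (c + X%:R) * _](subnKC le_jL) natrD; lra.
Qed.

Lemma mul_bin_bin k m n : (k <= m)%N -> (m <= n)%N ->
  ('C(n, m) * 'C(m, k) = 'C(n, k) * 'C(n - k, m - k))%N.
Proof.
move=> le_km le_mn; have le_kn := leq_trans le_km le_mn.
have fact_pos : (0 < k`! * ((m - k)`! * (n - m)`!))%N by rewrite !muln_gt0 !fact_gt0.
apply/eqP; rewrite -(eqn_pmul2r fact_pos); apply/eqP; transitivity n`!.
  rewrite -(bin_fact le_mn) -(bin_fact le_km).
  by move: 'C(_, _) 'C(_, _) (k`!) ((m - k)`!) ((n - m)`!) => *; lia.
have le_sub : (m - k <= n - k)%N by apply: leq_sub2r.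
have sub_sub : (n - k - (m - k) = n - m)%N by lia.
rewrite -(bin_fact le_kn) -(bin_fact le_sub) sub_sub.
by move: 'C(_, _) 'C(_, _) (k`!) ((m - k)`!) ((n - m)`!) => *; lia.
Qed.

Lemma leq_bin_mirror x p q :
  (p <= q)%N -> (x <= p + q)%N -> ('C(x, q) <= 'C(x, p))%N.
Proof.
elim: x p q => [|x IHx] p q le_pq le_x.
  by case: q le_pq {le_x} => [|q]; rewrite ?leqn0 ?bin0n // => /eqP ->.
have [-> // | neq_pq] := eqVneq p q.
case: q le_pq le_x neq_pq => [|q] le_pq le_x neq_pq; first by lia.
case: p le_pq le_x neq_pq => [|p] le_pq le_x neq_pq.
  by have [-> | ltq] := eqVneq x q; rewrite ?binn ?bin0 // bin_small //; lia.
by rewrite !binS addnC leq_add // IHx; lia.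
Qed.

Lemma linear_combination (V : zmodType) (p q x y : V) :
  p = q -> x - y = p - q -> x = y.
Proof. by move=> ->; rewrite subrr => /eqP; rewrite subr_eq0 => /eqP. Qed.

(** * The recursion for the normalized coefficients *)

Local Notation "'c^' n" := (nseq n false) (at level 8, n at level 2, format "'c^' n").
Local Notation "u ':d:' v" := (u ++ true :: v) (at level 60, right associativity).

Section NormalizedBeta.
Context {R : realFieldType} (b : seq bool -> R).
Implicit Types (f g : seq bool -> R) (i j k m n : nat) (A Z : seq bool).

Hypothesis b_rec : forall v,
  2 * (cd_degree v).+1%:R * b v =
    2 * word_empty v + word_split false word_empty b v
      + word_split false b word_empty v + word_split true b b v.

Definition rpeel f Z := word_split false f word_empty Z + word_split true f b Z.
Definition lpeel f A := word_split false word_empty f A + word_split true b f A.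

Definition lstart Z := 2 * word_empty Z + word_split false word_empty b Z.

Lemma b_rpeel Z : 2 * (cd_degree Z).+1%:R * b Z = rpeel b Z + lstart Z.
Proof. by rewrite b_rec /rpeel /lstart; ring. Qed.

Lemma b_nil : b [::] = 1.
Proof.
have := b_rec [::]; rewrite cd_degree_nil /word_split !big_ord0 /word_empty /=.
by move=> b0; lra.
Qed.

Lemma b_gt0 v : 0 < b v.
Proof.
have [n] := ubnP (size v); elim: n v => // n IHn [|x v] /= lt_vn.
  by rewrite b_nil.
have b_ge0 u : (size u <= size v)%N -> 0 <= b u.
  by move=> le_uv; apply/ltW/IHn/(leq_ltn_trans le_uv).
have bv_gt0 : 0 < b v by apply: IHn.
suff: 0 < 2 * (cd_degree (x :: v)).+1%:R * b (x :: v).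
  by rewrite pmulr_rgt0 // mulr_gt0.
have empty_ge0 u : (size u <= size v)%N -> 0 <= word_empty u :> R.
  by move=> _; apply: word_empty_ge0.
rewrite b_rec; case: x {lt_vn}.
  apply: ltr_wpDl; rewrite ?word_split_cons_gt0 ?b_nil //.
  by rewrite !addr_ge0 ?mulr_ge0 ?word_empty_ge0 ?word_split_ge0.
rewrite -!addrA ltr_wpDl ?mulr_ge0 ?word_empty_ge0 // ltr_wpDr //.
  by rewrite addr_ge0 ?word_split_ge0.
by rewrite word_split_cons_gt0 // /word_empty eqxx.
Qed.

Lemma b_rev v : b (rev v) = b v.
Proof.
have [n] := ubnP (size v); elim: n v => // n IHn v lt_vn.
have factor_neq0 : 2 * (cd_degree v).+1%:R != 0 :> R by rewrite mulf_neq0 ?pnatr_eq0.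
apply: (mulfI factor_neq0); rewrite -{1}cd_degree_rev !b_rec !word_split_rev.
have b_revE u w x : v = u ++ x :: w -> b (rev u) = b u /\ b (rev w) = b w.
  by move=> vE; rewrite !IHn //; move: lt_vn; rewrite vE size_cat /=; lia.
have empty_rev u : word_empty (rev u) = word_empty u :> R.
  by rewrite /word_empty -size_eq0 size_rev size_eq0.
rewrite empty_rev -!addrA; congr (_ + _).
rewrite addrCA; congr (_ + (_ + _)); apply: eq_word_split => u w /b_revE[bu bw] /=.
- by rewrite empty_rev bw.
- by rewrite bu empty_rev.
- by rewrite bu bw.
Qed.

Lemma rpeelB f g Z : rpeel (fun u => f u - g u) Z = rpeel f Z - rpeel g Z.
Proof. by rewrite /rpeel !word_splitBl; ring. Qed.

Lemma rpeel0 Z : rpeel (fun=> 0) Z = 0.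
Proof. by rewrite /rpeel !word_split_eq0 ?addr0 // => u w _; rewrite mul0r. Qed.

Lemma rpeelZ f a Z : rpeel (fun u => a * f u) Z = a * rpeel f Z.
Proof. by rewrite /rpeel !word_splitZl mulrDr. Qed.

Lemma lpeelB f g A : lpeel (fun w => f w - g w) A = lpeel f A - lpeel g A.
Proof. by rewrite /lpeel !word_splitBr; ring. Qed.

Lemma eq_rpeel f g Z : f =1 g -> rpeel f Z = rpeel g Z.
Proof.
by move=> eqfg; congr (_ + _); apply: eq_word_split => u w _; rewrite eqfg.
Qed.

Lemma eq_lpeel f g A : f =1 g -> lpeel f A = lpeel g A.
Proof.
by move=> eqfg; congr (_ + _); apply: eq_word_split => u w _; rewrite eqfg.
Qed.

Lemma rpeel_ge0 f Z :
  (forall u, (size u < size Z)%N -> 0 <= f u) -> 0 <= rpeel f Z.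
Proof.
by move=> f_ge0; rewrite addr_ge0 ?word_split_ge0 // => u _; apply/ltW/b_gt0.
Qed.

Lemma lpeel_ge0 f A :
  (forall w, (size w < size A)%N -> 0 <= f w) -> 0 <= lpeel f A.
Proof.
by move=> f_ge0; rewrite addr_ge0 ?word_split_ge0 // => u _; apply/ltW/b_gt0.
Qed.

Lemma lstart_ge0 Z : 0 <= lstart Z.
Proof.
rewrite addr_ge0 ?mulr_ge0 ?word_empty_ge0 // word_split_ge0 // => u _.
exact/ltW/b_gt0.
Qed.

(* [rpeel f Z] only involves the values of [f] at words shorter than [Z]. *)
Lemma rpeel_le f g (c : seq bool -> R) :
    (forall Z, 0 < c Z) ->
    (forall Z, rpeel g Z - rpeel f Z <= c Z * (g Z - f Z)) ->
  forall Z, f Z <= g Z.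
Proof.
move=> c_gt0 fg_super Z; have [n] := ubnP (size Z); elim: n Z => // n IHn Z lt_Zn.
rewrite -subr_ge0 -(pmulr_rge0 _ (c_gt0 Z)); apply: le_trans (fg_super Z).
rewrite -rpeelB rpeel_ge0 // => u lt_uZ; rewrite subr_ge0 IHn //.
exact: leq_trans lt_uZ _.
Qed.

Lemma rpeel_unique f g (c : seq bool -> R) :
    (forall Z, 0 < c Z) ->
    (forall Z, c Z * (f Z - g Z) = rpeel f Z - rpeel g Z) ->
  forall Z, f Z = g Z.
Proof.
move=> c_gt0 fgE Z; apply/eqP; rewrite eq_le; apply/andP.
split; apply: (rpeel_le c_gt0) => {}Z; last by rewrite fgE.
by rewrite -opprB -fgE -mulrN opprB.
Qed.

Lemma lpeel_nseq f i :
  lpeel f (c^ i) = if i is i'.+1 then f (c^ i') else 0.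
Proof.
rewrite /lpeel (word_split_nseq (x := true)) // addr0; case: i => [|i] /=.
  exact: big_ord0.
rewrite word_split_cons /= word_split_eq0 => [|u w _]; last by rewrite mul0r.
by rewrite addr0 mul1r.
Qed.

Lemma rpeel_nseq f i :
  rpeel f (c^ i) = if i is i'.+1 then f (c^ i') else 0.
Proof.
rewrite /rpeel (word_split_nseq (x := true)) // addr0; case: i => [|i] /=.
  exact: big_ord0.
rewrite -[false :: _]/(nseq i.+1 false) -addn1 nseqD word_split_cat.
rewrite word_split_eq0 => [|u w _]; last first.
  by rewrite /word_empty cats1 -size_eq0 size_rcons mulr0.
rewrite add0r word_split_cons /= cats0 mulr1 word_split_eq0 ?addr0 // => u w.
by case: u.
Qed.

Lemma word_empty_catd u w : word_empty (u :d: w) = 0 :> R.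
Proof. by rewrite /word_empty; case: u. Qed.

Lemma lpeel_join f A A' :
  lpeel f (A :d: A') =
    lpeel (fun w => f (w :d: A')) A + b A * f A'
      + word_split true (fun u => b (A :d: u)) f A'.
Proof.
rewrite /lpeel !word_split_cat !word_split_cons /= cats0.
rewrite (word_split_eq0 (f := fun w => word_empty (A :d: w))) => [|u w _]; last first.
  by rewrite word_empty_catd mul0r.
by ring.
Qed.

Lemma b_join A Z :
  2 * (cd_degree A + cd_degree Z + 3)%:R * b (A :d: Z) =
    lpeel (fun w => b (w :d: Z)) A + b A * b Z + rpeel (fun u => b (A :d: u)) Z.
Proof.
have degE : (cd_degree (A :d: Z)).+1 = (cd_degree A + cd_degree Z + 3)%N.
  by rewrite !cd_degreeE; lia.
have b_lpeel v : 2 * (cd_degree v).+1%:R * b v =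
    2 * word_empty v + lpeel b v + word_split false b word_empty v.
  by rewrite b_rec /lpeel; ring.
rewrite -degE b_lpeel word_empty_catd lpeel_join word_split_cat word_split_cons /=.
rewrite (word_split_eq0 (g := fun w => word_empty (w :d: Z))) => [|u w _]; last first.
  by rewrite word_empty_catd mulr0.
by rewrite /rpeel; ring.
Qed.

Lemma b_nseq i : b (c^ i) = (i.+1)`!%:R^-1.
Proof.
elim: i => [|i IHi]; first by rewrite b_nil invr1.
have lstartE : lstart (c^ i.+1) = lpeel b (c^ i.+1).
  by rewrite /lpeel (word_split_nseq (x := true)) // addr0 /lstart mulr0 add0r.
have := b_rpeel (c^ i.+1); rewrite lstartE rpeel_nseq lpeel_nseq cd_degree_nseq IHi.
rewrite [(i.+2)`!]factS natrM invfM => rec_b.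
have factor_neq0 : i.+2%:R != 0 :> R by rewrite pnatr_eq0.
by apply: (mulfI factor_neq0); rewrite mulrA divff // mul1r; lra.
Qed.

Definition b_cd i Z := b (c^ i :d: Z).
Definition b_cd_pred i Z := if i is i'.+1 then b_cd i' Z else 0.

Lemma b_cd_gt0 i Z : 0 < b_cd i Z.
Proof. exact: b_gt0. Qed.

Lemma b_cd_rec i Z :
  2 * (cd_degree Z + i + 3)%:R * b_cd i Z =
    b_cd_pred i Z + b Z / (i.+1)`!%:R + rpeel (b_cd i) Z.
Proof.
have := b_join (c^ i) Z; rewrite -/(b_cd i Z) cd_degree_nseq [(i + _)%N]addnC => ->.
rewrite b_nseq lpeel_nseq [_^-1 * _]mulrC.
by case: i.
Qed.

Lemma b_cd0E Z : b_cd 0 Z = 2 * b_cd 1 Z.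
Proof.
move: Z; apply: (rpeel_unique (c := fun Z => 2 * (cd_degree Z + 4)%:R)) => Z.
  by rewrite mulr_gt0 // ltr0n addn4.
rewrite rpeelZ; apply: linear_combination.
  exact: (congr2 +%R (b_cd_rec 0 Z) (congr1 ( *%R (-2)) (b_cd_rec 1 Z))).
by rewrite /b_cd_pred (_ : 1`! = 1%N) // (_ : 2`! = 2%N) //; field.
Qed.

Lemma b_cd_upper i Z : i.+2%:R * b_cd i.+1 Z <= b_cd i Z.
Proof.
elim: i Z => [|i IHi]; first by move=> Z; rewrite b_cd0E.
apply: (rpeel_le (c := fun Z => 2 * (cd_degree Z + i + 5)%:R)) => Z.
  by rewrite mulr_gt0 // ltr0n addnS.
rewrite rpeelZ -subr_ge0.
suff -> : 2 * (cd_degree Z + i + 5)%:R * (b_cd i.+1 Z - i.+3%:R * b_cd i.+2 Z) -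
    (rpeel (b_cd i.+1) Z - i.+3%:R * rpeel (b_cd i.+2) Z) =
    (b_cd i Z - i.+2%:R * b_cd i.+1 Z) + b_cd i.+1 Z.
  by rewrite addr_ge0 ?subr_ge0 // ltW // b_cd_gt0.
have fact_div : b Z / (i.+2)`!%:R = i.+3%:R * (b Z / (i.+3)`!%:R).
  by rewrite [(i.+3)`!]factS natrM invfM mulrCA mulVKf // pnatr_eq0.
apply: linear_combination.
  exact: (congr2 +%R (b_cd_rec i.+1 Z) (congr1 ( *%R (- i.+3%:R)) (b_cd_rec i.+2 Z))).
by rewrite fact_div /b_cd_pred; ring.
Qed.

(* The moments of a positive measure on [[0, 1]] that is symmetric under
   [x -> 1 - x] and has total mass [2 * b Z]. *)
Definition moment i Z :=
  match i with
  | 0 => 2 * b Z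
  | 1 => b Z
  | i'.+2 => b Z - i`!%:R * b_cd i' Z
  end.

Lemma moment_rec i Z :
  2 * (cd_degree Z + 1 + i)%:R * moment i Z =
    i%:R * moment i.-1 Z + rpeel (moment i) Z + lstart Z * (1 + (i == 0%N)%:R).
Proof.
case: i => [|[|i]].
- rewrite rpeelZ; apply: linear_combination (congr1 ( *%R 2) (b_rpeel Z)) _.
  by rewrite /moment /=; ring.
- apply: linear_combination (b_rpeel Z) _.
  by rewrite /moment [rpeel (fun _ => _) Z]/(rpeel b Z) /=; ring.
have fact_div : (i.+2)`!%:R * (b Z / (i.+1)`!%:R) = i.+2%:R * b Z.
  by rewrite [(i.+2)`!]factS natrM -mulrA [_`!%:R * _]mulrC divfK ?factr_neq0.
have moment_pred : i.+2%:R * moment i.+2.-1 Z =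
    i.+2%:R * b Z - (i.+2)`!%:R * b_cd_pred i Z.
  case: i {fact_div} => [|i] /=; first by rewrite mulr0 subr0.
  by rewrite mulrBr [(i.+3)`!]factS natrM mulrA.
rewrite rpeelB rpeelZ moment_pred addr0 mulr1; apply: linear_combination.
  exact: (congr2 +%R (congr2 +%R (b_rpeel Z)
    (congr1 ( *%R (- (i.+2)`!%:R)) (b_cd_rec i Z))) (congr1 -%R fact_div)).
by rewrite /moment; ring.
Qed.

(* The moment of [x^j (1 - x)^k]. *)
Fixpoint mixed_moment j k Z :=
  if k is k'.+1 then mixed_moment j k' Z - mixed_moment j.+1 k' Z else moment j Z.

Lemma mixed_moment_rec j k Z :
  (2 * (cd_degree Z).+1 + (j + k))%:R * mixed_moment j k Z =
    j%:R * mixed_moment j.-1 k.+1 Z + k%:R * mixed_moment j.+1 k.-1 Z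
      + rpeel (mixed_moment j k) Z + lstart Z * ((j == 0%N)%:R + (k == 0%N)%:R).
Proof.
elim: k j => [|k IHk] j.
  rewrite -[rpeel _ Z]/(rpeel (moment j) Z) [mixed_moment _ _ _]/=.
  apply: linear_combination (moment_rec j Z) _.
  by case: j => [|j]; rewrite /=; ring.
rewrite [rpeel _ Z]rpeelB; apply: linear_combination.
  exact: (congr2 +%R (IHk j) (congr1 -%R (IHk j.+1))).
by case: k {IHk} => [|k]; case: j => [|j]; rewrite /=; ring.
Qed.

Lemma moment_system_ge0 (F g : nat -> nat -> seq bool -> R) :
    (forall j k Z, (2 * (cd_degree Z).+1 + (j + k))%:R * F j k Z =
      j%:R * F j.-1 k.+1 Z + k%:R * F j.+1 k.-1 Z + rpeel (F j k) Z + g j k Z) ->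
    (forall j k Z, 0 <= g j k Z) ->
  forall j k Z, 0 <= F j k Z.
Proof.
move=> F_rec g_ge0 j k Z; have [n] := ubnP (size Z).
elim: n j k Z => // n IHn j k Z lt_Zn; pose L := (j + k)%N.
have -> : k = (L - j)%N by rewrite /L addKn.
have mass_gt0 : 0 < (2 * (cd_degree Z).+1)%:R :> R by rewrite ltr0n.
pose f i := F i (L - i)%N Z.
apply: (discrete_min_principle (f := f) mass_gt0) (leq_addr k j) => i le_iL.
rewrite -natrD -{2}(subnKC le_iL) {}/f F_rec.
have rpeel_F : 0 <= rpeel (F i (L - i)%N) Z.
  by apply: rpeel_ge0 => u lt_uZ; apply: IHn; apply: leq_trans lt_uZ _.
have left_term : i%:R * F i.-1 (L - i.-1)%N Z = i%:R * F i.-1 (L - i).+1 Z.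
  case: (posnP i) => [-> | i_gt0]; first by rewrite !mul0r.
  by have -> : (L - i.-1 = (L - i).+1)%N by lia.
rewrite left_term subnS; have := g_ge0 i (L - i)%N Z; lra.
Qed.

Lemma mixed_moment_ge0 j k Z : 0 <= mixed_moment j k Z.
Proof.
apply: (moment_system_ge0 mixed_moment_rec) => {}j {}k {}Z.
by rewrite mulr_ge0 ?lstart_ge0 // addr_ge0.
Qed.

Lemma mixed_moment_gt0 j k Z : 0 < mixed_moment j k Z.
Proof.
have rest_ge0 i l : 0 <= rpeel (mixed_moment i l) Z
    + lstart Z * ((i == 0%N)%:R + (l == 0%N)%:R).
  apply: addr_ge0; last by rewrite mulr_ge0 ?lstart_ge0 // addr_ge0.
  by apply: rpeel_ge0 => u _; apply: mixed_moment_ge0.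
have factor_gt0 i : 0 < (2 * (cd_degree Z).+1 + i)%:R :> R by rewrite ltr0n.
elim: k j => [|k IHk] j.
  elim: j => [|j IHj]; first by rewrite /= mulr_gt0 ?b_gt0.
  have mass_gt0 : 0 < 2 * (cd_degree Z + 1 + j.+1)%:R :> R.
    by rewrite mulr_gt0 // ltr0n addnS.
  rewrite -(pmulr_rgt0 _ mass_gt0) moment_rec -addrA.
  apply: ltr_wpDr; last by rewrite mulr_gt0 ?ltr0n.
  apply: addr_ge0; last by rewrite mulr_ge0 ?lstart_ge0 // addr_ge0.
  by apply: rpeel_ge0 => u _; apply: (mixed_moment_ge0 _ 0).
rewrite -(pmulr_rgt0 _ (factor_gt0 (j + k.+1)%N)) mixed_moment_rec -addrA.
apply: ltr_wpDr => //; apply: ltr_wpDl; last by rewrite mulr_gt0 ?ltr0n.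
by rewrite mulr_ge0 ?mixed_moment_ge0.
Qed.

Lemma mixed_momentC j k Z : mixed_moment j k Z = mixed_moment k j Z.
Proof.
suff diff_ge0 i l : 0 <= mixed_moment i l Z - mixed_moment l i Z.
  by apply/eqP; rewrite eq_le -subr_ge0 diff_ge0 -subr_ge0 diff_ge0.
apply: (moment_system_ge0 (F := fun i l Z => mixed_moment i l Z - mixed_moment l i Z)
  (g := fun _ _ _ => 0)) => // {}i {}l {}Z.
rewrite rpeelB; apply: linear_combination.
  exact: (congr2 +%R (mixed_moment_rec i l Z) (congr1 -%R (mixed_moment_rec l i Z))).
ring.
Qed.

Lemma b_cd_lower i Z : b_cd i Z < i.+3%:R * b_cd i.+1 Z.
Proof.
have momentE : mixed_moment i.+2 1 Z =
    (i.+2)`!%:R * (i.+3%:R * b_cd i.+1 Z - b_cd i Z).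
  by rewrite /= [(i.+3)`!]factS natrM; ring.
have := mixed_moment_gt0 i.+2 1 Z; rewrite momentE pmulr_rgt0 ?subr_gt0 //.
by rewrite ltr0n fact_gt0.
Qed.

Lemma b_cd_order m1 n1 m2 n2 Y Z : (m1 + n1 = m2 + n2)%N ->
  (minn m2 n2 < minn m1 n1)%N -> b_cd m2 Y * b_cd n2 Z < b_cd m1 Y * b_cd n1 Z.
Proof.
have ratio_lt A A' k l : (k < l)%N ->
    b_cd k A * b_cd l.+1 A' < b_cd k.+1 A * b_cd l A'.
  move=> lt_kl; apply: (@lt_le_trans _ _ (k.+3%:R * b_cd k.+1 A * b_cd l.+1 A')).
    by rewrite ltr_pM2r ?b_cd_gt0 // b_cd_lower.
  rewrite mulrAC mulrC ler_pM2l ?b_cd_gt0 //; apply: le_trans (b_cd_upper _ _).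
  by rewrite ler_pM2r ?b_cd_gt0 // ler_nat; lia.
exact: prod_lt_of_balanced (b_cd_gt0^~ Y) (b_cd_gt0^~ Z)
  (ratio_lt Y Z) (ratio_lt Z Y).
Qed.

Lemma factr_b_cd_antitone m n Z : (m <= n)%N ->
  (n.+1)`!%:R * b_cd n Z <= (m.+1)`!%:R * b_cd m Z.
Proof.
move=> /subnK <-; elim: (n - m)%N => // k; apply: le_trans.
rewrite addSn [(_.+2)`!]factS natrM [_ * _`!%:R]mulrC -mulrA ler_wpM2l //.
exact: b_cd_upper.
Qed.

Lemma b_cd_rev m A : b (A :d: c^ m) = b_cd m (rev A).
Proof. by rewrite -b_rev rev_cat rev_cons cat_rcons rev_nseq. Qed.

Lemma b_cd_nseqC m n : b_cd m (c^ n) = b_cd n (c^ m).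
Proof. by rewrite -[LHS]/(b (c^ m :d: c^ n)) b_cd_rev rev_nseq. Qed.

Lemma b_cd_pred_nseq m n :
  b_cd_pred m (c^ n) =
    ((m`!%:R * (n.+1)`!%:R)^-1 - ((m + n).+1)`!%:R^-1) / (m + n + 2)%:R.
Proof.
have [l] := ubnP (m + n); elim: l m n => // l IHl [|m] n lt_mn.
  by rewrite mul1r add0n subrr mul0r.
have rpeelE : rpeel (b_cd m) (c^ n) =
    (((m.+1)`!%:R * n`!%:R)^-1 - ((m + n).+1)`!%:R^-1) / (m + n + 2)%:R.
  rewrite rpeel_nseq; case: n lt_mn => [|n] lt_mn.
    by rewrite mulr1 addn0 subrr mul0r.
  by rewrite -[b_cd m _]/(b_cd_pred m.+1 (c^ n)) IHl ?addSnnS //; lia.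
have := b_cd_rec m (c^ n); rewrite cd_degree_nseq rpeelE b_nseq IHl; last by lia.
have factor_neq0 : 2 * (n + m + 3)%:R != 0 :> R by rewrite mulf_neq0 ?addn3 ?pnatr_eq0.
move=> rec_b; apply: (mulfI factor_neq0); rewrite [LHS]rec_b addSn !factS !natrM.
have := factr_neq0 R m; have := factr_neq0 R n; have := factr_neq0 R (m + n).
move: (m`!%:R) (n`!%:R) ((m + n)`!%:R) => x y z x0 y0 z0.
have m_ge0 : 0 <= m%:R :> R by []; have n_ge0 : 0 <= n%:R :> R by [].
field; rewrite x0 y0 z0 /=.
by do ?[apply/andP; split]; rewrite lt0r_neq0 //; lra.
Qed.

Definition b_cdcd m n Z := b (c^ m :d: c^ n :d: Z).
Definition b_cdcd_predl m n Z := if m is m'.+1 then b_cdcd m' n Z else 0.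
Definition b_cdcd_predr m n Z := if n is n'.+1 then b_cdcd m n' Z else 0.

Lemma b_cdcd_gt0 m n Z : 0 < b_cdcd m n Z.
Proof. exact: b_gt0. Qed.

Lemma b_cdcd_rec m n Z :
  2 * (cd_degree Z + m + n + 5)%:R * b_cdcd m n Z =
    b_cdcd_predl m n Z + b_cd n Z / (m.+1)`!%:R + b_cd m (c^ n) * b Z
      + rpeel (b_cdcd m n) Z.
Proof.
have := b_join (c^ m :d: c^ n) Z.
rewrite -catA cat_cons -/(b_cdcd m n Z) !cd_degreeE.
have -> : (m + (2 + n) + cd_degree Z + 3 = cd_degree Z + m + n + 5)%N by lia.
move=> ->; congr (_ + _ + _); last first.
  by apply: eq_rpeel => u; rewrite -catA cat_cons.
rewrite lpeel_join (word_split_nseq (x := true)) // addr0 lpeel_nseq b_nseq.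
rewrite [_^-1 * _]mulrC; congr (_ + _).
by case: m => //= m; rewrite -catA cat_cons.
Qed.

Lemma b_cdcd_predl_rec m n Z :
  2 * (cd_degree Z + m + n + 4)%:R * b_cdcd_predl m n Z =
    (if m is m'.+1 then b_cdcd_predl m' n Z + b_cd n Z / m`!%:R else 0)
      + b_cd_pred m (c^ n) * b Z + rpeel (b_cdcd_predl m n) Z.
Proof.
case: m => [|m]; first by rewrite rpeel0 mulr0 mul0r !addr0.
have -> : (cd_degree Z + m.+1 + n + 4 = cd_degree Z + m + n + 5)%N by lia.
exact: b_cdcd_rec.
Qed.

Lemma b_cdcd_predr_rec m n Z :
  2 * (cd_degree Z + m + n + 4)%:R * b_cdcd_predr m n Z =
    (if m is m'.+1 then b_cdcd_predr m' n Z else 0) + b_cd_pred n Z / (m.+1)`!%:R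
      + b_cd_pred n (c^ m) * b Z + rpeel (b_cdcd_predr m n) Z.
Proof.
case: n => [|n]; first by rewrite rpeel0; case: m => [|m] /=; ring.
have -> : (cd_degree Z + m + n.+1 + 4 = cd_degree Z + m + n + 5)%N by lia.
by rewrite /= b_cdcd_rec b_cd_nseqC.
Qed.

Lemma b_cdcd_adjacent m n Z :
  b_cdcd_predl m n Z + b_cdcd_predr m n Z =
    b_cd n Z / (m.+1)`!%:R - 2 * b_cd (m + n).+1 Z.
Proof.
suff -> : b_cdcd_predl m n Z =
    ((m.+1)`!%:R^-1 * b_cd n Z - 2 * b_cd (m + n).+1 Z) - b_cdcd_predr m n Z by ring.
have c_gt0 k l Y : 0 < 2 * (cd_degree Y + k + l + 4)%:R :> R.
  by rewrite mulr_gt0 // ltr0n addnS.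
elim: m n Z => [|m IHm] n.
  apply: (rpeel_unique (c_gt0 0%N n)) => Z.
  rewrite !(rpeelB, rpeelZ) addn0; apply: linear_combination.
    exact: (congr2 +%R (congr2 +%R (b_cdcd_predl_rec 0 n Z) (b_cdcd_predr_rec 0 n Z))
      (congr2 +%R (congr1 -%R (b_cd_rec n Z)) (congr1 ( *%R 2) (b_cd_rec n.+1 Z)))).
  rewrite !b_cd_pred_nseq add0n !addn0 /= (_ : 1`! = 1%N) // fact0 !factS !natrM.
  have := factr_neq0 R n; move: (n`!%:R) => x x0.
  have n_ge0 : 0 <= n%:R :> R by [].
  field; rewrite x0 /=.
  by do ?[apply/andP; split]; rewrite lt0r_neq0 //; lra.
apply: (rpeel_unique (c_gt0 m.+1 n)) => Z.
rewrite !(rpeelB, rpeelZ); apply: linear_combination.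
  exact: (congr2 +%R
    (congr2 +%R (b_cdcd_predl_rec m.+1 n Z) (b_cdcd_predr_rec m.+1 n Z))
    (congr2 +%R (IHm n Z)
      (congr2 +%R (congr1 ( *%R (- (m.+2)`!%:R^-1)) (b_cd_rec n Z))
        (congr1 ( *%R 2) (b_cd_rec (m.+1 + n).+1 Z))))).
rewrite !b_cd_pred_nseq [(n + m.+1)%N]addnC addSn /= !factS !natrM.
have := factr_neq0 R m; have := factr_neq0 R n; have := factr_neq0 R (m + n).
move: (m`!%:R) (n`!%:R) ((m + n)`!%:R) => x y z z0 y0 x0.
have m_ge0 : 0 <= m%:R :> R by []; have n_ge0 : 0 <= n%:R :> R by [].
field; rewrite x0 y0 z0 /=.
by do ?[apply/andP; split]; rewrite lt0r_neq0 //; lra.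
Qed.

Lemma mixed_moment_telescope l r Z :
  \sum_(i < l.+1) mixed_moment (r + i) (l - i) Z *+ 'C(l, i) = moment r Z.
Proof.
elim: l r => [|l IHl] r; first by rewrite big_ord1 bin0 addn0.
rewrite (sum_binS (fun i => mixed_moment (r + i) (l.+1 - i) Z)) -IHl.
apply: eq_bigr => i _; congr (_ *+ _); have lt_il := ltn_ord i.
by rewrite subSS addnS subSn //= subrK.
Qed.

(* By [alternating_moment_pascal], an alternating sum of the
   ['C(L, i) * moment i] for [i <= r]; in this form all the terms are
   nonnegative. *)
Definition alternating_moment L r Z :=
  \sum_(j < L) mixed_moment j.+1 (L - j.+1) Z *+ ('C(L, j.+1) * 'C(j, r)).

Lemma alternating_moment0 L Z : alternating_moment L 0 Z = 2 * b Z - moment L Z.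
Proof.
rewrite -[2 * b Z]/(moment 0 Z) -(mixed_moment_telescope L) big_ord_recl.
rewrite bin0 subn0 addn0.
rewrite -[moment L Z]/(mixed_moment L 0 Z) mixed_momentC addrAC subrr add0r.
by apply: eq_bigr => j _; rewrite lift0 bin0 muln1 add0n.
Qed.

Lemma alternating_moment_pascal L r Z : (r < L)%N ->
  alternating_moment L r.+1 Z + alternating_moment L r Z =
    moment r.+1 Z *+ 'C(L, r.+1).
Proof.
move=> /subnKC <-; move: (L - r.+1)%N => {L} l; set L := (r.+1 + l)%N.
transitivity (\sum_(i < L.+1) mixed_moment i (L - i) Z *+ ('C(L, i) * 'C(i, r.+1))).
  rewrite /alternating_moment -big_split [RHS]big_ord_recl bin0n muln0 mulr0n add0r.
  by apply: eq_bigr => j _ /=; rewrite -mulrnDr -mulnDr -binS.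
rewrite -(mixed_moment_telescope l) -sumrMnl /L -addnS big_split_ord /=.
rewrite [X in X + _]big1 ?add0r => [|i _]; last by rewrite (@bin_small i) ?muln0.
apply: eq_bigr => i _; have lt_i := ltn_ord i.
rewrite mul_bin_bin ?leq_addr ?leq_add2l // !addKn subnDl.
by rewrite -mulrnA mulnC.
Qed.

Definition alternating_deficit L r Z :=
  b Z *+ 'C(L.-1, r) - alternating_moment L r Z.

Lemma alternating_deficitS L r Z : (r < L)%N ->
  alternating_deficit L r.+1 Z =
    (b Z - moment r.+1 Z) *+ 'C(L, r.+1) - alternating_deficit L r Z.
Proof.
move=> lt_rL; apply: linear_combination.
  exact: (congr1 -%R (alternating_moment_pascal Z lt_rL)).
by rewrite /alternating_deficit -(ltn_predK lt_rL) /= binS !mulrnDr mulrnBl; ring.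
Qed.

Lemma alternating_deficit1 L Z :
  alternating_deficit L.+3 1 Z = (L.+3)`!%:R * b_cd L.+1 Z.
Proof.
rewrite alternating_deficitS // [moment 1 Z]/= subrr mul0rn /alternating_deficit.
by rewrite alternating_moment0 bin0 mulr1n /moment; ring.
Qed.

Lemma moment_deficit L k Z : (k.+2 <= L)%N ->
  (b Z - moment k.+2 Z) *+ 'C(L, k.+2) = L`!%:R / ((L - k.+2)`!)%:R * b_cd k Z.
Proof.
move=> le_kL; rewrite /moment opprB addrC subrK -mulr_natr -(bin_fact le_kL) !natrM.
by rewrite !mulrA mulfK ?factr_neq0 //; ring.
Qed.

Lemma b_cdcd_explicit m n Z :
  ((m + n + 3)`!)%:R * (b_cdcd_predl m n Z + b_cd (m + n).+1 Z) =
    alternating_deficit (m + n + 3) n.+2 Z.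
Proof.
have predl_of_predr k l : let L := (k + l + 3)%N in
    L`!%:R * (b_cdcd_predr k l Z + b_cd (k + l).+1 Z) =
      alternating_deficit L l.+1 Z ->
    L`!%:R * (b_cdcd_predl k l Z + b_cd (k + l).+1 Z) =
      alternating_deficit L l.+2 Z.
  move=> L predrE; rewrite alternating_deficitS ?moment_deficit; try lia.
  have -> : (L - l.+2 = k.+1)%N by lia.
  apply: linear_combination (congr2 +%R (congr1 -%R predrE)
    (congr1 ( *%R L`!%:R) (b_cdcd_adjacent k l Z))) _.
  ring.
elim: n m => [|n IHn] m; apply: predl_of_predr.
  by rewrite addn0 addn3 alternating_deficit1 add0r.
by have := IHn m.+1; rewrite !addSnnS.
Qed.

Lemma b_cdcd_lt_flip m n Z : (m < n)%N -> b_cdcd n.+1 m Z < b_cdcd m.+1 n Z.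
Proof.
move=> lt_mn; have := b_cdcd_explicit n.+2 m Z; have := b_cdcd_explicit m.+2 n Z.
have -> : (n.+2 + m = m.+2 + n)%N by lia.
set L := (m.+2 + n + 3)%N => explicit_m explicit_n.
have factL_gt0 : 0 < L`!%:R :> R by rewrite ltr0n fact_gt0.
rewrite -(ltrD2r (b_cd (m.+2 + n).+1 Z)) -(ltr_pM2l factL_gt0).
rewrite [X in X < _]explicit_n [X in _ < X]explicit_m /alternating_deficit.
have -> : 'C(L.-1, n.+2) = 'C(L.-1, m.+2).
  by rewrite -bin_sub; [congr 'C(_, _) | ]; lia.
rewrite ltrD2l ltrN2.
have lt_mL : (m.+2 < L)%N by lia.
rewrite /alternating_moment (bigD1 (Ordinal lt_mL)) //=.
rewrite [X in _ < X](bigD1 (Ordinal lt_mL)) //= ltr_leD //.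
  rewrite (@bin_small m.+2 n.+2) // muln0 mulr0n binn muln1.
  by rewrite pmulrn_lgt0 ?mixed_moment_gt0 // bin_gt0; lia.
apply: ler_sum => i _; rewrite ler_wpMn2l ?mixed_moment_ge0 // leq_mul2l.
by rewrite leq_bin_mirror ?orbT //; have := ltn_ord i; lia.
Qed.

Lemma b_cdcd_flip m n Z : (m < n)%N -> b_cdcd m n Z <= b_cdcd n m Z.
Proof.
have [s] := ubnP (m + n); elim: s m n Z => // s IHs m n Z lt_s lt_mn; move: Z.
apply: (rpeel_le (c := fun Z => 2 * (cd_degree Z + m + n + 5)%:R)) => Z.
  by rewrite mulr_gt0 // ltr0n addnS.
rewrite -subr_ge0.
suff -> : 2 * (cd_degree Z + m + n + 5)%:R * (b_cdcd n m Z - b_cdcd m n Z)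
    - (rpeel (b_cdcd n m) Z - rpeel (b_cdcd m n) Z) =
  (b_cdcd_predl n m Z - b_cdcd_predl m n Z)
    + (b_cd m Z / (n.+1)`!%:R - b_cd n Z / (m.+1)`!%:R).
  apply: addr_ge0; rewrite subr_ge0; last first.
    have fact_pos k : 0 < (k.+1)`!%:R :> R by rewrite ltr0n fact_gt0.
    rewrite ler_pdivrMr // mulrAC ler_pdivlMr // mulrC [X in _ <= X]mulrC.
    exact/factr_b_cd_antitone/ltnW.
  case: n lt_s lt_mn => // n lt_s lt_mn; case: m lt_s lt_mn => [|m] lt_s lt_mn.
    exact/ltW/b_cdcd_gt0.
  apply/ltW/(@lt_of_balanced _ (m + n.+1) (fun k l => b_cdcd k l Z)); try lia.
    by move=> k l lt_kl kl_sum; apply: IHs => //; lia.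
  by move=> k l lt_kl _; apply: b_cdcd_lt_flip.
apply: linear_combination.
  exact: (congr2 +%R (b_cdcd_rec n m Z) (congr1 -%R (b_cdcd_rec m n Z))).
by rewrite (b_cd_nseqC m n); ring.
Qed.

Lemma b_cdcd_order m1 n1 m2 n2 Z : (m1 + n1 = m2 + n2)%N ->
  (minn m2 n2 < minn m1 n1)%N -> b_cdcd m2 n2 Z < b_cdcd m1 n1 Z.
Proof.
move=> eq_sum; apply: (@lt_of_balanced _ (m1 + n1) (fun m n => b_cdcd m n Z)) => //.
  by move=> m n lt_mn _; apply: b_cdcd_flip.
by move=> m n lt_mn _; apply: b_cdcd_lt_flip.
Qed.

Lemma b_cdc_order m1 n1 m2 n2 : (m1 + n1 = m2 + n2)%N ->
  (minn m2 n2 < minn m1 n1)%N -> b (c^ m2 :d: c^ n2) < b (c^ m1 :d: c^ n1).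
Proof.
move=> eq_sum lt_min.
have bE m n : b (c^ m :d: c^ n) = b_cd_pred m.+1 (c^ n) by [].
rewrite !bE !b_cd_pred_nseq !addSn eq_sum.
rewrite ltr_pM2r ?invr_gt0 ?ltr0n ?addn2 // ltrD2r !invfM.
pose f k : R := ((k.+1)`!%:R)^-1.
have f_gt0 k : 0 < f k by rewrite invr_gt0 ltr0n fact_gt0.
have fS k : f k.+1 = f k / k.+2%:R by rewrite /f factS natrM invfM mulrC.
have f_ratio k l : (k < l)%N -> f k * f l.+1 < f k.+1 * f l.
  move=> lt_kl; rewrite !fS mulrA [X in _ < X]mulrAC ltr_pM2l ?mulr_gt0 //.
  by rewrite ltf_pV2 ?posrE ?ltr0n // ltr_nat.
exact: (prod_lt_of_balanced f_gt0 f_gt0 f_ratio f_ratio).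
Qed.

Lemma b_cdcd_rev m n A : b (A :d: c^ m :d: c^ n) = b_cdcd n m (rev A).
Proof.
by rewrite -b_rev rev_cat rev_cons rev_cat rev_cons !cat_rcons !rev_nseq -catA.
Qed.

Definition b_dcdcd m n A Z := b (A :d: c^ m :d: c^ n :d: Z).

Lemma b_dcdcd_rec m n A Z :
  2 * (cd_degree A + cd_degree Z + m + n + 7)%:R * b_dcdcd m n A Z =
    lpeel (fun w => b_dcdcd m n w Z) A + b A * b_cdcd m n Z
      + b_cd m (rev A) * b_cd n Z + b_cdcd n m (rev A) * b Z
      + rpeel (b_dcdcd m n A) Z.
Proof.
have := b_join (A :d: c^ m :d: c^ n) Z.
rewrite !cd_degreeE -!catA /= -!catA /= -/(b_dcdcd m n A Z).
have -> : (cd_degree A + (2 + (m + (2 + n))) + cd_degree Z + 3 =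
  cd_degree A + cd_degree Z + m + n + 7)%N by lia.
move=> ->; rewrite b_cdcd_rev lpeel_join word_split_cat word_split_cons /= cats0.
rewrite !(word_split_nseq (x := true)) // add0r addr0 b_cd_rev.
rewrite -[b ((c^ m :d: c^ n) :d: Z)]/(b _) -catA -/(b_cdcd m n Z) -/(b_cd n Z).
congr (_ + _ + _ + _ + _); [apply: eq_lpeel | apply: eq_rpeel] => u;
  by rewrite -!catA /= -!catA.
Qed.

Lemma b_dcdcd_order m1 n1 m2 n2 A Z : (m1 + n1 = m2 + n2)%N ->
  (minn m2 n2 < minn m1 n1)%N -> b_dcdcd m2 n2 A Z < b_dcdcd m1 n1 A Z.
Proof.
move=> eq_sum lt_min; have [k] := ubnP (size A + size Z).
elim: k A Z => // k IHk A Z lt_k; rewrite -subr_gt0.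
have factor_gt0 : 0 < 2 * (cd_degree A + cd_degree Z + m1 + n1 + 7)%:R :> R.
  by rewrite mulr_gt0 // ltr0n addnS.
rewrite -(pmulr_rgt0 _ factor_gt0) mulrBr b_dcdcd_rec.
rewrite -(addnA _ m1) eq_sum addnA b_dcdcd_rec.
have lpeel_diff : 0 <= lpeel (b_dcdcd m1 n1 ^~ Z) A - lpeel (b_dcdcd m2 n2 ^~ Z) A.
  by rewrite -lpeelB lpeel_ge0 // => w lt_wA; rewrite subr_ge0 ltW // IHk //; lia.
have rpeel_diff : 0 <= rpeel (b_dcdcd m1 n1 A) Z - rpeel (b_dcdcd m2 n2 A) Z.
  by rewrite -rpeelB rpeel_ge0 // => u lt_uZ; rewrite subr_ge0 ltW // IHk //; lia.
have A_term : b A * b_cdcd m2 n2 Z < b A * b_cdcd m1 n1 Z.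
  by rewrite ltr_pM2l ?b_gt0 // b_cdcd_order.
have middle_term := b_cd_order (rev A) Z eq_sum lt_min.
have Z_term : b_cdcd n2 m2 (rev A) * b Z < b_cdcd n1 m1 (rev A) * b Z.
  by rewrite ltr_pM2r ?b_gt0 //; apply: b_cdcd_order; lia.
lra.
Qed.

End NormalizedBeta.

Lemma cd_word_cons p s : s != [::] -> cd_word (p :: s) = c^ p :d: cd_word s.
Proof. by case: s. Qed.

Lemma cd_word_cat M N : M != [::] -> N != [::] ->
  cd_word (M ++ N) = cd_word M :d: cd_word N.
Proof.
elim: M => // p M IHM _ N_neq0; have [-> | M_neq0] := eqVneq M [::].
  by rewrite cat1s cd_word_cons.
rewrite cat_cons !cd_word_cons ?IHM -?catA //.
by case: M M_neq0 {IHM}.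
Qed.

Lemma cd_word_pair m n : cd_word [:: m; n] = c^ m :d: c^ n.
Proof. by []. Qed.

Lemma cd_degree_word s : cd_degree (cd_word s) = (sumn s + 2 * (size s).-1)%N.
Proof.
elim: s => [|p s IHs]; first exact: cd_degree_nil.
have [-> | s_neq0] := eqVneq s [::]; first by rewrite /= cd_degree_nseq !addn0.
rewrite cd_word_cons // !cd_degreeE IHs /=.
by case: s s_neq0 {IHs} => //= q s _; lia.
Qed.

Lemma ler_beta s t : sumn s = sumn t -> size s = size t ->
  (beta s <= beta t) = (normalized_beta (cd_word s) <= normalized_beta (cd_word t)).
Proof.
move=> eq_sum eq_size; rewrite !normalized_betaE !cd_degree_word eq_sum eq_size.
by rewrite ler_pM2r ?ler_int // invr_gt0 ltr0n fact_gt0.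
Qed.

Lemma ltr_beta s t : sumn s = sumn t -> size s = size t ->
  (beta s < beta t) = (normalized_beta (cd_word s) < normalized_beta (cd_word t)).
Proof. by move=> eq_sum eq_size; rewrite !ltNge ler_beta. Qed.

Lemma beta_pairC m n : beta [:: m; n] = beta [:: n; m].
Proof.
have nbetaC :
    normalized_beta (cd_word [:: m; n]) = normalized_beta (cd_word [:: n; m]).
  rewrite !cd_word_pair -(b_rev normalized_beta_rec).
  by rewrite rev_cat rev_cons !rev_nseq cat_rcons.
by apply/eqP; rewrite eq_le !ler_beta /= ?nbetaC ?lexx // !addn0 addnC.
Qed.

Lemma beta_flip M m n : (m < n)%N -> beta (M ++ [:: n; m]) <= beta (M ++ [:: m; n]).
Proof.
move=> lt_mn; have [-> | M_neq0] := eqVneq M [::]; first by rewrite !cat0s beta_pairC.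
rewrite ler_beta ?size_cat //; last by rewrite !sumn_cat /=; lia.
rewrite !cd_word_cat // !cd_word_pair !(b_cdcd_rev normalized_beta_rec).
exact: (b_cdcd_flip normalized_beta_rec).
Qed.

Lemma beta_order M N m1 n1 m2 n2 :
    (m1 + n1 = m2 + n2)%N -> (minn m2 n2 < minn m1 n1)%N ->
  beta (M ++ [:: m2; n2] ++ N) < beta (M ++ [:: m1; n1] ++ N).
Proof.
move=> eq_sum lt_min; rewrite ltr_beta ?size_cat //; last first.
  by rewrite !sumn_cat /=; lia.
have [-> | M_neq0] := eqVneq M [::]; have [-> | N_neq0] := eqVneq N [::].
- by rewrite !cats0 !cat0s; apply: (b_cdc_order normalized_beta_rec).
- rewrite !cat0s !cd_word_cat // !cd_word_pair -!catA /=.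
  exact: (b_cdcd_order normalized_beta_rec).
- rewrite !cats0 !cd_word_cat // !cd_word_pair !(b_cdcd_rev normalized_beta_rec).
  by apply: (b_cdcd_order normalized_beta_rec); lia.
rewrite !cd_word_cat // !cd_word_pair -!catA /=.
exact: (b_dcdcd_order normalized_beta_rec).
Qed.

Theorem theorem7p3 (m n m1 n1 m2 n2 : nat) (M N : seq nat)
    (hmn : (m < n)%N)
    (hsum : (m1 + n1 = m2 + n2)%N)
    (hdiff : (`|m1%:Z - n1%:Z| < `|m2%:Z - n2%:Z|)%R) :
  ((beta (M ++ [:: m; n]) >= beta (M ++ [:: n; m]))%R /\
   (M = [::] -> beta (M ++ [:: m; n]) = beta (M ++ [:: n; m]))) /\
  (beta (M ++ [:: m1; n1] ++ N) > beta (M ++ [:: m2; n2] ++ N))%R.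
Proof.
split; last by apply: beta_order => //; lia.
split; first exact: beta_flip.
by move=> ->; apply: beta_pairC.
Qed.
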